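(* Let $x,a,b,c$ be non-negative integers and let $B'_{x,a,b,c}$ be the weighted region defined in the context. If $b$ is odd, then \[ \operatorname{M}(B'_{x,a,b,c})=\operatorname{M}(P'_{c,c,a})\frac{\operatorname{V}(2x+2a+b+2,c-1,\lfloor\frac{c+1}{2}\rfloor)}{\operatorname{V}(2a+b+2,c-1,\lfloor\frac{c+1}{2}\rfloor)}\cdot\frac{\operatorname{T}(x+1,2a+b+c-1,b)\,\operatorname{T}(x+a+\frac{b+1}{2},c,\lfloor\frac{c+1}{2}\rfloor)}{\operatorname{T}(1,2a+b+c-1,b)\,\operatorname{T}(a+\frac{b+1}{2},c,\lfloor\frac{c+1}{2}\rfloor)}, \] and if $b$ is even, then \[ \operatorname{M}(B'_{x,a,b,c})=\operatorname{M}(P'_{c,c,a})\frac{\operatorname{V}(2x+2a+b+1,c,\lfloor\frac{c+1}{2}\rfloor)}{\operatorname{V}(2a+b+1,c,\lfloor\frac{c+1}{2}\rfloor)}\cdot\frac{\operatorname{T}(x+1,2a+b+c-1,b)\,\operatorname{T}(x+a+\frac{b+2}{2},c-1,\lfloor\frac{c+1}{2}\rfloor)}{\operatorname{T}(1,2a+b+c-1,b)\,\operatorname{T}(a+\frac{b+2}{2},c-1,\lfloor\frac{c+1}{2}\rfloor)}. \]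
   Context: Notation. For real $x$ and integer $n$: $(x)_n=x(x+1)\cdots(x+n-1)$ if $n>0$, $(x)_0=1$, $(x)_n=1/((x-1)(x-2)\cdots(x+n))$ if $n<0$; $[x]_n=x(x+2)\cdots(x+2(n-1))$ if $n>0$, $[x]_0=1$, $[x]_n=1/((x-2)(x-4)\cdots(x+2n))$ if $n<0$. $\operatorname{T}(x,n,m)=\prod_{i=0}^{m-1}(x+i)_{n-2i}$ if $m>0$, $=1$ if $m=0$, $=\operatorname{T}(x,n,-m)^{-1}$ if $m<0$; $\operatorname{V}(x,n,m)=\prod_{i=0}^{m-1}[x+2i]_{n-2i}$ if $m>0$, $=1$ if $m=0$, $=\operatorname{V}(x,n,-m)^{-1}$ if $m<0$. Lattice and tilings. Regions lie on the triangular lattice drawn with one family of lattice lines horizontal. A lozenge is the union of two unit triangles sharing an edge; a vertical lozenge is one whose two unit triangles share a horizontal edge. If lozenges carry weights, the weight of a tiling is the product of the weights of its lozenges, and $\operatorname{M}(R)$ is the sum of the weights of all lozenge tilings of $R$ (unweighted lozenges have weight $1$). A halved hexagon is a region whose western boundary is a vertical zigzag lattice path (unit segments alternating between the two non-horizontal lattice directions, running downward along a vertical line $\ell$), the other sides being lattice segments: a horizontal northern side, a northeastern side, a southeastern side, a horizontal southern side and possibly a southwestern side. A zigzag step consists of two consecutive unit segments of the zigzag; a removed half-triangle is the part to the right of $\ell$ of a lattice triangle bisected by $\ell$; it is at level $k$ from the top if its horizontal side lies $k$ zigzag steps ($2k$ rows of unit triangles) below the northern side. $P'_{a,b,c}$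 (for $a\le b$): the semi-regular hexagon with side-lengths $a,b,c,a,b,c$ (counterclockwise from the northwestern side) with a maximal staircase cut off (a halved hexagon with zigzag western side), in which each vertical lozenge along the zigzag cut has weight $\frac12$ and all other lozenges weight $1$. (By Ciucu's theorem, $\operatorname{M}(P'_{a,b,c})=2^{-a}\prod_{i=1}^{a}\frac{2c+b-a+i}{c+b-a+i}\prod_{i=1}^{a}[\prod_{j=1}^{b-a+1}\frac{c+i+j-1}{i+j-1}\prod_{j=b-a+2}^{b-a+i}\frac{2c+i+j-1}{i+j-1}]$.) $B'_{x,a,b,c}$: take the halved hexagon whose northern, northeastern, southeastern, southern and southwestern sides have lengths $x+a,\ b+c,\ 2a+c,\ x,\ b+1$ and whose western side is a zigzag lattice path of length $a+c$; give each vertical lozenge along the western side weight $\frac12$; then remove from the western side the right half of a down-pointing triangle of side $2a$, at level $c$ from the top. *)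

(* Defs.v *)
From HB Require Import structures.
From mathcomp Require Import all_boot all_order all_algebra.
From mathcomp Require Import zify.

Set Implicit Arguments.
Unset Strict Implicit.
Unset Printing Implicit Defensive.

Import Order.TTheory GRing.Theory Num.Theory.
Local Open Scope ring_scope.

Section ShiftedFactorials.
Variable R : numFieldType.

(* (x)_n; recall that [Negz k] is the integer -(k+1). *)
Definition poch (x : R) (n : int) : R :=
  match n with
  | Posz k => \prod_(i < k) (x + i%:R)
  | Negz k => (\prod_(i < k.+1) (x - i.+1%:R))^-1
  end.

(* [x]_n *)
Definition poch2 (x : R) (n : int) : R :=
  match n with
  | Posz k => \prod_(i < k) (x + (2 * i)%:R)
  | Negz k => (\prod_(i < k.+1) (x - (2 * i.+1)%:R))^-1
  end.

Definition Tpos (x : R) (n : int) (m : nat) : R :=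
  \prod_(i < m) poch (x + i%:R) (n - (2 * i)%:Z).

Definition T (x : R) (n m : int) : R :=
  match m with
  | Posz k => Tpos x n k
  | Negz k => (Tpos x n k.+1)^-1
  end.

Definition Vpos (x : R) (n : int) (m : nat) : R :=
  \prod_(i < m) poch2 (x + (2 * i)%:R) (n - (2 * i)%:Z).

Definition V (x : R) (n m : int) : R :=
  match m with
  | Posz k => Vpos x n k
  | Negz k => (Vpos x n k.+1)^-1
  end.

End ShiftedFactorials.

(* The plane has coordinates (X, y): X is twice the abscissa, measured from   *)
(* the vertical line l (so l is X = 0, and a horizontal unit segment has      *)
(* X-length 2), and y is the depth below the northern side.  The lattice      *)
(* points are the integer (X, y) with X + y even; in particular the northern  *)
(* end of l is a lattice point.                                               *)
Definition point := (int * int)%type.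

(* The unit triangle (r, k) lies between depths r and r + 1 and is centred at *)
(* X = k.  It points up when r + k is even and down otherwise.  The zigzag    *)
(* (0,0), (-1,1), (0,2), (-1,3), ... has exactly the unit triangles with      *)
(* k >= 0 on its right, those with k = 0 being bisected by l.  Hence letting  *)
(* k range over nat amounts to cutting along this zigzag.                     *)
Definition corners (r k : nat) : seq point :=
  if odd (r + k) then
    [:: (k%:Z, r%:Z + 1); (k%:Z - 1, r%:Z); (k%:Z + 1, r%:Z)]
  else
    [:: (k%:Z, r%:Z); (k%:Z - 1, r%:Z + 1); (k%:Z + 1, r%:Z + 1)].

(* Finite window of unit triangles right of the zigzag: h rows, w columns. *)
Definition tri (h w : nat) := ('I_h * 'I_w)%type.

Section Tilings.
Variables (R : numFieldType) (h w : nat).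
Implicit Types (s t : tri h w) (L D : {set tri h w}).

Definition row_of t : nat := t.1.
Definition col_of t : nat := t.2.

Definition tri_corners t : seq point := corners (row_of t) (col_of t).

(* s points up and t is its mirror image in their common horizontal edge *)
Definition share_horizontal s t : bool :=
  [&& ~~ odd (row_of s + col_of s), row_of t == (row_of s).+1
    & col_of t == col_of s].

Definition share_slanted s t : bool :=
  (row_of t == row_of s) && (col_of t == (col_of s).+1).

Definition lozenge L : bool :=
  [exists s, exists t,
     (L == [set s; t]) && (share_horizontal s t || share_slanted s t)].

(* vertical lozenge whose two triangles are bisected by l *)
Definition zigzag_lozenge L : bool :=
  [exists s, exists t,
     [&& L == [set s; t], share_horizontal s t & col_of s == 0%N]].

Definition lozenge_weight L : R := if zigzag_lozenge L then 2^-1 else 1.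

Definition tiling D (P : {set {set tri h w}}) : bool :=
  partition P D && [forall L in P, lozenge L].

Definition M D : R :=
  \sum_(P : {set {set tri h w}} | tiling D P) \prod_(L in P) lozenge_weight L.

End Tilings.

(* Hexagon with sides a, b, c, a, b, c counterclockwise from the northwestern *)
(* side, whose top left corner is (0, 0); the inequalities are, in order,     *)
(* those of the N and S, NW, SW, NE and SE sides.                             *)
Definition hexagon (a b c : nat) (v : point) : bool :=
  let: (X, y) := v in
  [&& 0 <= y <= (a + b)%:Z, 0 <= X + y, y <= X + (2 * a)%:Z,
      X <= (2 * c)%:Z + y & X + y <= (2 * c + 2 * b)%:Z].

Lemma hexagon_window (a b c r k : nat) :
  all (hexagon a b c) (corners r k) -> (r < a + b)%N && (k < 2 * c + b)%N.
Proof. by rewrite /corners; case: ifP => _ /=; lia. Qed.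

(* Meaningful for a <= b: the zigzag then ends on the SW side. *)
Definition P' (a b c : nat) : {set tri (a + b) (2 * c + b)} :=
  [set t | all (hexagon a b c) (tri_corners t)].

(* The N and S, NE, SE and SW sides of the halved hexagon.  The zigzag has    *)
(* a + c steps and ends at (0, 2(a+c)), where the SW line is met; the last    *)
(* unit segment of the zigzag, from (-1, 2(a+c)-1) to (0, 2(a+c)), is on the  *)
(* SW line, so that this side has length b + 1 when that segment is counted   *)
(* with it.  The southern side has length x.                                  *)
Definition halved_hexagon (x a b c : nat) (v : point) : bool :=
  let: (X, y) := v in
  [&& 0 <= y <= (2 * a + b + 2 * c)%:Z, X <= (2 * (x + a))%:Z + y,
      X + y <= (2 * (x + a) + 2 * (b + c))%:Z & y <= X + (2 * (a + c))%:Z].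

Lemma halved_hexagon_window (x a b c r k : nat) :
  all (halved_hexagon x a b c) (corners r k) ->
  (r < 2 * a + b + 2 * c)%N && (k < 2 * (x + a) + (b + c))%N.
Proof. by rewrite /corners; case: ifP => _ /=; lia. Qed.

(* Down-pointing triangle of side 2a with horizontal side from (-2a, 2c) to   *)
(* (2a, 2c), bisected by l; it reaches down to (0, 2(a+c)).  A unit triangle  *)
(* with k >= 0 overlaps the right half iff it is contained in the triangle.   *)
Definition dent (a c : nat) (v : point) : bool :=
  let: (X, y) := v in
  [&& (2 * c)%:Z <= y, X + y <= (2 * (a + c))%:Z & y <= X + (2 * (a + c))%:Z].

Definition B' (x a b c : nat) :
    {set tri (2 * a + b + 2 * c) (2 * (x + a) + (b + c))} :=
  [set t | all (halved_hexagon x a b c) (tri_corners t)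
           && ~~ all (dent a c) (tri_corners t)].

(* Main.v *)
Require Import Defs.
From mathcomp Require Import all_boot all_order fingroup perm all_algebra.
From mathcomp Require Import zify ring.
Set Implicit Arguments.
Unset Strict Implicit.
Unset Printing Implicit Defensive.
Import Order.TTheory GRing.Theory Num.Theory.
Local Open Scope ring_scope.

(** The lozenges with a horizontal side form non-crossing paths that run down from
    the [x + a] unit edges of the northern side and end in the [a] edges on top of
    the removed triangle and the [x] edges of the southern side.  At the zigzag a
    path replaces a lozenge of weight 1/2, so up to the factor [2 ^- c] each visit
    to the zigzag counts twice, and the paths between two points are the
    walks on a line folded at [l].  Sweeping the region one unit triangle at a time
    expresses [M] as a determinant of folded walk numbers, and [P'] gives the same
    determinant for [x = 0].

    Unitriangular row operations turn the entries into binomial coefficients.  After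
    division by row factors the columns are [Q f] and [P g] evaluated at
    [m = c, c + 1, ..., c + a + x - 1], where [f] and [g] run through bases of the
    polynomials of degree less than [a] and [x], and [P], [Q] are rising factorials of
    degrees [a + be] and [x + be] with [be = b / 2].  Adding [be] more points and [be]
    columns that vanish at the old points, and changing the bases, every
    column becomes a rising factorial [(m + s)_(n - 1)] with [n = a + x + be]: the
    determinant is a Vandermonde determinant in [s], which runs through three
    arithmetic progressions.  The quotient of the values at [x + 1] and [x] is then
    a quotient of factorials, and so is that of the right-hand sides. *)

(** * Peeling a lozenge *)

Section Peeling.
Variables (R : numFieldType) (h w : nat).
Implicit Types (t : tri h w) (L D : {set tri h w}) (P : {set {set tri h w}}).

(** The equation [(L |: P) :\ L == P] encodes that [L] is not in [P]. This is the bijection between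
    tilings that use [L] and tilings of the rest, in the form that [reindex_onto] produces. *)
Lemma tiling_setU1 D L P :
  tiling D (L |: P) && ((L |: P) :\ L == P)
  = [&& lozenge L, L \subset D & tiling (D :\: L) P].
Proof.
have Ln0 : lozenge L -> L != set0.
  case/existsP=> s /existsP[t /andP[/eqP-> _]].
  by apply/set0Pn; exists s; rewrite !inE eqxx.
apply/idP/idP.
- case/andP=> /andP[/and3P[/eqP covD tI n0] /forall_inP loz] /eqP PL.
  have LnP : L \notin P by rewrite -PL !inE eqxx.
  have lozL : lozenge L by apply: loz; rewrite !inE eqxx.
  have disj B : B \in P -> [disjoint L & B].
    move=> BP; apply: (trivIsetP tI); rewrite ?inE ?eqxx ?BP ?orbT //.
    by apply: contraNneq LnP => ->.
  have covE : D = L :|: cover P by rewrite -covD /cover bigcup_setU big_set1.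
  rewrite lozL /=; apply/and3P; split.
  + by rewrite covE subsetUl.
  + apply/and3P; split.
    * rewrite covE setDUl setDv set0U; apply/eqP/esym/setDidPl.
      rewrite disjoint_sym /cover.
      by apply/bigcup_disjointP.
    * by apply: trivIsetS tI; apply: subsetUr.
    * by apply: contraNN n0; apply: (subsetP (subsetUr _ _)).
  + by apply/forall_inP=> B BP; apply: loz; rewrite inE BP orbT.
- case/and3P=> lozL LD /andP[/and3P[/eqP covD tI n0] /forall_inP loz].
  have disj B : B \in P -> [disjoint L & B].
    move=> BP; rewrite disjoint_sym; apply: disjointWl (_ : [disjoint D :\: L & L]).
      by rewrite -covD; apply: bigcup_sup.
    by rewrite -setI_eq0 setIDAC setDIl setDv setI0.
  have LnP : L \notin P.
    apply/negP=> LP; have := disj _ LP.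
    by rewrite -setI_eq0 setIid; apply/negP/Ln0.
  apply/andP; split; last by rewrite setU1K.
  apply/andP; split.
  + apply/and3P; split.
    * rewrite /cover bigcup_setU big_set1 -/(cover P) covD.
      apply/eqP/setP=> u; rewrite !inE.
      by case: (boolP (u \in L)) => // /(subsetP LD)->.
    * apply/trivIsetP=> B C; rewrite !inE.
      move=> /orP[/eqP->|BP] /orP[/eqP->|CP] nBC.
      - by rewrite eqxx in nBC.
      - exact: disj.
      - by rewrite disjoint_sym; exact: disj.
      - by apply: (trivIsetP tI).
    * rewrite !inE negb_or n0 andbT eq_sym; exact: Ln0.
  + by apply/forall_inP=> B; rewrite inE in_set1 => /orP[/eqP->|/loz].
Qed.

(** Tilings are grouped by the block that covers [t]; deleting this block leaves a tiling of the
    rest. *)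
Lemma M_peel D t : t \in D ->
  M R D = \sum_(L | [&& lozenge L, L \subset D & t \in L])
            lozenge_weight R L * M R (D :\: L).
Proof.
move=> tD; rewrite /M.
rewrite (partition_big (fun P => pblock P t)
  (fun L => [&& lozenge L, L \subset D & t \in L])) /=; last first.
  move=> P /andP[/and3P[/eqP covD tI n0] /forall_inP loz].
  have tc : t \in cover P by rewrite covD.
  rewrite mem_pblock tc andbT loz ?pblock_mem //=.
  by rewrite -covD; apply: (bigcup_sup (pblock P t)); rewrite ?pblock_mem.
apply: eq_bigr => L /and3P[lozL LD tL].
rewrite (reindex_onto (fun P => L |: P) (fun P => P :\ L)) /=; last first.
  move=> P /andP[/andP[/and3P[/eqP covD tI n0] _] /eqP <-].
  by rewrite setD1K // pblock_mem // covD.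
rewrite big_distrr /=; apply: eq_big => P.
  apply/idP/idP.
    case/andP=> /andP[til _] e; have := tiling_setU1 D L P.
    by rewrite til e /= lozL LD.
  move=> til; have := tiling_setU1 D L P.
  rewrite lozL LD til /= => /andP[til' ->]; rewrite til' andbT /=.
  case/andP: til' => /and3P[_ tI _] _.
  by apply/eqP; apply: def_pblock tI _ tL; rewrite !inE eqxx.
move=> /andP[/andP[til _] e].
rewrite big_setU1 //=.
by move/eqP: e => <-; rewrite !inE eqxx.
Qed.

Lemma M_set0 : M R (set0 : {set tri h w}) = 1.
Proof.
rewrite /M (big_pred1 set0) ?big_set0 // => P.
apply/idP/eqP => [/andP[/and3P[/eqP c _ n0] _]|->].
  apply/setP=> B; rewrite inE; apply/negP=> BP.
  have : B \subset set0 by rewrite -c; apply: bigcup_sup.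
  by rewrite subset0 => /eqP B0; rewrite -B0 BP in n0.
apply/andP; split; last by apply/forall_inP=> B; rewrite inE.
by rewrite /partition /cover big_set0 eqxx inE /= andbT; apply/trivIsetP=> B C; rewrite inE.
Qed.
End Peeling.

(** * Regions given by a predicate on rows and columns *)

Section Regions.
Variables (R : numFieldType) (h w : nat).
Implicit Types (F : nat -> nat -> bool).

Definition region F : {set tri h w} := [set t | F (row_of t) (col_of t)].

Definition without F (s t : nat * nat) (r k : nat) : bool :=
  [&& F r k, (r, k) != s & (r, k) != t].

Lemma eq_region F1 F2 :
  (forall r k, (r < h)%N -> (k < w)%N -> F1 r k = F2 r k) ->
  region F1 = region F2.
Proof. by move=> e; apply/setP=> t; rewrite !inE e /row_of /col_of ?ltn_ord. Qed.

Lemma ex_tri r k : (r < h)%N -> (k < w)%N ->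
  exists t : tri h w, row_of t = r /\ col_of t = k.
Proof. by move=> hr hk; exists (Ordinal hr, Ordinal hk). Qed.

Lemma tri_inj (s t : tri h w) : row_of s = row_of t -> col_of s = col_of t -> s = t.
Proof.
by case: s t => [s1 s2] [t1 t2]; rewrite /row_of /col_of /= => /val_inj-> /val_inj->.
Qed.

Lemma tri_eq (s t : tri h w) :
  ((row_of s, col_of s) == (row_of t, col_of t)) = (s == t).
Proof.
apply/eqP/eqP => [[]|-> //]; exact: tri_inj.
Qed.

Lemma region_without F (s t : tri h w) :
  region F :\: [set s; t] =
  region (without F (row_of s, col_of s) (row_of t, col_of t)).
Proof.
by apply/setP=> u; rewrite !inE /without !tri_eq negb_or andbC andbA.
Qed.

Lemma zigzag_lozenge_slanted (s t : tri h w) :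
  row_of s = row_of t -> zigzag_lozenge [set s; t] = false.
Proof.
move=> e; apply/existsP=> -[u /existsP[v /and3P[/eqP E sh _]]].
have rowE (z : tri h w) : z \in [set s; t] -> row_of z = row_of s.
  by rewrite !inE => /orP[]/eqP->.
case/and3P: sh => _ /eqP + _.
by rewrite !rowE ?E ?inE ?eqxx ?orbT // => /n_Sn.
Qed.

Lemma zigzag_lozenge_vertical (s t : tri h w) :
  share_horizontal s t -> zigzag_lozenge [set s; t] = (col_of s == 0%N).
Proof.
move=> sh; apply/existsP/idP=> [[u /existsP[v /and3P[/eqP E _ /eqP c0]]]|c0].
  have colE (z : tri h w) : z \in [set s; t] -> col_of z = col_of s.
    by rewrite !inE; case/and3P: sh => _ _ /eqP et /orP[]/eqP->.
  by rewrite -(colE u) ?c0 // E !inE eqxx.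
by exists s; apply/existsP; exists t; rewrite eqxx sh c0.
Qed.

Definition vertical_weight k : R := if k == 0%N then 2^-1 else 1.

(** Once the left neighbour is gone, and for a down-pointing triangle the upper one too, a triangle
    can only be matched to the right or, if it points up, downwards. The sweep always peels such a
    triangle, so each step has at most two terms. *)
Lemma region_peel F r k :
  (forall r k, F r k -> (r < h)%N && (k < w)%N) ->
  F r k -> (forall l, k = l.+1 -> ~~ F r l) ->
  (odd (r + k) -> forall q, r = q.+1 -> ~~ F q k) ->
  M R (region F) =
    (F r k.+1)%:R * M R (region (without F (r, k) (r, k.+1)))
    + (~~ odd (r + k) && F r.+1 k)%:R
      * (vertical_weight k * M R (region (without F (r, k) (r.+1, k)))).
Proof.
move=> Fw Frk Fl Fu.
have [t [tr tc]] : exists t : tri h w, row_of t = r /\ col_of t = k.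
  by case/andP: (Fw _ _ Frk) => hr hk; apply: ex_tri.
(* A neighbour outside the region is represented by the dummy [t]; the condition [bs] or [bu] below
   is then false. *)
have [s sP] : exists s : tri h w, F r k.+1 -> row_of s = r /\ col_of s = k.+1.
  case E: (F r k.+1); last by exists t.
  by case/andP: (Fw _ _ E) => hr hk; have [s ?] := ex_tri hr hk; exists s.
have [u uP] : exists u : tri h w, F r.+1 k -> row_of u = r.+1 /\ col_of u = k.
  case E: (F r.+1 k); last by exists t.
  by case/andP: (Fw _ _ E) => hr hk; have [v ?] := ex_tri hr hk; exists v.
set bs := F r k.+1; set bu := _ && F r.+1 k.
rewrite (@M_peel _ _ _ _ t); last by rewrite inE tr tc.
have LE (L : {set tri h w}) :
    [&& lozenge L, L \subset region F & t \in L] =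
    (bs && (L == [set t; s])) || (bu && (L == [set t; u])).
  apply/idP/idP.
  - case/and3P=> /existsP[v /existsP[v' /andP[/eqP-> sh]]] /subsetP sub tL.
    have Fv : F (row_of v) (col_of v).
      by have := sub v; rewrite !inE eqxx; apply.
    have Fv' : F (row_of v') (col_of v').
      by have := sub v'; rewrite !inE eqxx orbT; apply.
    move: tL; rewrite !inE => /orP[]/eqP et.
    + subst v; case/orP: sh => [/and3P[up /eqP r' /eqP c']|/andP[/eqP r' /eqP c']].
      * move: Fv' up; rewrite r' c' tr tc => Fv' up.
        have [ur uc] := uP Fv'.
        have -> : v' = u by apply: tri_inj; congruence.
        by rewrite /bu up Fv' eqxx orbT.
      * move: Fv'; rewrite r' c' tr tc => Fv'.
        have [ur uc] := sP Fv'.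
        have -> : v' = s by apply: tri_inj; congruence.
        by rewrite /bs Fv' eqxx.
    + subst v'; case/orP: sh => [/and3P[up /eqP r' /eqP c']|/andP[/eqP r' /eqP c']].
      * have o : odd (r + k) by rewrite -tr -tc r' c' addSn oddS up.
        by have := Fu o (row_of v); rewrite -tr r' -tc c' Fv => /(_ erefl).
      * by have := Fl (col_of v); rewrite -tr r' -tc c' Fv => /(_ erefl).
  - have tF : t \in region F by rewrite inE tr tc.
    case/orP=> /andP[b /eqP->]; rewrite !inE eqxx andbT.
    + have [sr sc] := sP b; apply/andP; split.
        apply/existsP; exists t; apply/existsP; exists s.
        by rewrite eqxx /share_slanted sr sc tr tc !eqxx orbT.
      by rewrite subUset !sub1set tF inE sr sc.
    + case/andP: b => up b; have [sr sc] := uP b; apply/andP; split.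
        apply/existsP; exists t; apply/existsP; exists u.
        by rewrite eqxx /share_horizontal sr sc tr tc !eqxx up.
      by rewrite subUset !sub1set tF inE sr sc.
rewrite (eq_bigl _ _ LE) (bigID (fun L => bs && (L == [set t; s]))) /=.
congr (_ + _).
- case: (boolP bs) => b /=; last first.
    by rewrite mul0r big_pred0 // => L; rewrite andbF.
  have [sr sc] := sP b.
  rewrite (big_pred1 [set t; s]); last by move=> L /=; case: (L == [set t; s]); rewrite ?andbF.
  rewrite /lozenge_weight zigzag_lozenge_slanted ?sr ?tr // !mul1r.
  by rewrite region_without sr sc tr tc.
- case: (boolP bu) => b /=; last first.
    by rewrite mul0r big_pred0 // => L; rewrite orbF andbN.
  case/andP: (b) => up b'; have [ur uc] := uP b'.
  have ne : bs -> ([set t; u] == [set t; s]) = false.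
    move=> b2; have [sr sc] := sP b2.
    apply/negP=> /eqP /setP/(_ u); rewrite !inE eqxx orbT.
    move=> /esym/orP[]/eqP e.
      by have := tr; rewrite -e ur => /esym/n_Sn.
    by have := sr; rewrite -e ur => /esym/n_Sn.
  rewrite (big_pred1 [set t; u]); last first.
    move=> L /=; case: (eqVneq L [set t; u]) => [->|_]; last first.
      by rewrite orbF andbN.
    by case: (boolP bs) => [/ne->|].
  have sh : share_horizontal t u.
    by rewrite /share_horizontal tr tc ur uc !eqxx up.
  rewrite /lozenge_weight zigzag_lozenge_vertical // tc mul1r.
  by rewrite region_without ur uc tr tc.
Qed.
End Regions.

(** * Sweeping a region *)

Section RowDeterminant.
Variables (R : comPzRingType) (n : nat).
Implicit Types (l : seq 'rV[R]_n) (u v : 'rV[R]_n).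

(** Rows come from a list because the sweep replaces the row at position [size l1] and moves rows
    from one segment to the next. *)
Definition rows_det l : R := \det (\matrix_(i < n) nth 0 l i).

Lemma nth_mid (T : Type) (x0 : T) (l1 l2 : seq T) (u : T) : nth x0 (l1 ++ u :: l2) (size l1) = u.
Proof. by rewrite nth_cat ltnn subnn. Qed.

Lemma nth_notmid (T : Type) (x0 : T) (l1 l2 : seq T) (u v : T) i : i != size l1 ->
  nth x0 (l1 ++ u :: l2) i = nth x0 (l1 ++ v :: l2) i.
Proof.
move=> ne; rewrite !nth_cat; case: ltnP => // le.
have : (0 < i - size l1)%N by rewrite subn_gt0 ltn_neqAle eq_sym ne.
by case: (i - size l1)%N.
Qed.

Lemma rows_det_lin l1 l2 (a b : R) u v : (size l1 < n)%N ->
  rows_det (l1 ++ (a *: u + b *: v) :: l2) =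
  a * rows_det (l1 ++ u :: l2) + b * rows_det (l1 ++ v :: l2).
Proof.
move=> lt; apply: (@determinant_multilinear _ _ _ _ _ (Ordinal lt)).
- by rewrite !rowK /= !nth_mid.
- apply/matrixP=> i j; rewrite !mxE; congr (fun_of_matrix _ _ _).
  by apply: nth_notmid; have := neq_lift (Ordinal lt) i; rewrite -val_eqE eq_sym.
- apply/matrixP=> i j; rewrite !mxE; congr (fun_of_matrix _ _ _).
  by apply: nth_notmid; have := neq_lift (Ordinal lt) i; rewrite -val_eqE eq_sym.
Qed.

Lemma rows_det_linD l1 l2 (a : R) u v : (size l1 < n)%N ->
  rows_det (l1 ++ (a *: u + v) :: l2) =
  a * rows_det (l1 ++ u :: l2) + rows_det (l1 ++ v :: l2).
Proof. by move=> lt; rewrite -[v in LHS]scale1r rows_det_lin // mul1r. Qed.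

Lemma rows_det_row0 l1 l2 : (size l1 < n)%N -> rows_det (l1 ++ 0 :: l2) = 0.
Proof.
move=> lt; have -> : 0 = 0 *: 0 + 0 *: 0 :> 'rV[R]_n by rewrite scaler0 addr0.
by rewrite rows_det_lin // !mul0r addr0.
Qed.

Lemma rows_det_dup l1 l2 u : (size l1 < n)%N -> u \in l1 ->
  rows_det (l1 ++ u :: l2) = 0.
Proof.
move=> lt ul1; have lt1 : (index u l1 < size l1)%N by rewrite index_mem.
apply: (@determinant_alternate _ _ _ (Ordinal (ltn_trans lt1 lt)) (Ordinal lt)).
  by rewrite -val_eqE /= neq_ltn lt1.
by move=> j; rewrite !mxE /= nth_mid nth_cat lt1 nth_index.
Qed.

Lemma rows_det_col0 l (j : 'I_n) : (forall u, u \in l -> u 0 j = 0) -> rows_det l = 0.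
Proof.
move=> z; rewrite /rows_det (expand_det_col _ j) big1 // => i _.
rewrite mxE; case: (ltnP i (size l)) => le; last by rewrite nth_default // mxE mul0r.
by rewrite z ?mul0r // mem_nth.
Qed.

Lemma rows_detM l (U : 'M[R]_n) :
  rows_det [seq u *m U | u <- l] = rows_det l * \det U.
Proof.
rewrite /rows_det -det_mulmx; congr (\det _); apply/row_matrixP=> i.
rewrite row_mul !rowK; case: (ltnP i (size l)) => le.
  by rewrite (nth_map 0).
by rewrite !nth_default ?size_map // mul0mx.
Qed.
End RowDeterminant.

Lemma sorted_ltn_split (s : seq nat) k :
  sorted ltn s -> (forall p, p \in s -> (k <= p)%N) -> k \in s ->
  exists s', [/\ s = k :: s', sorted ltn s' & forall p, p \in s' -> (k < p)%N].
Proof.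
case: s => // p s /= ps ge ks.
have lt : forall q, q \in s -> (p < q)%N.
  by apply/allP; apply: order_path_min ps; apply: ltn_trans.
have -> : p = k.
  apply/eqP; rewrite eqn_leq ge ?mem_head // andbT.
  by move: ks; rewrite inE => /orP[/eqP->|/lt/ltnW].
exists s; split=> //; first exact: path_sorted ps.
move=> q qs; apply: leq_ltn_trans (lt q qs); exact: ge (mem_head _ _).
Qed.

Lemma sorted_ltn_filter (s : seq nat) k : sorted ltn s ->
  s = [seq p <- s | (p < k)%N] ++ [seq p <- s | (k <= p)%N].
Proof.
elim: s => //= p s IH ps; have /IH {}IH := path_sorted ps.
case: ltnP => lt /=; first by rewrite -IH.
have /allP gt : all (ltn p) s by apply: order_path_min ps; apply: ltn_trans.
have -> : [seq q <- s | (q < k)%N] = [::].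
  rewrite (@eq_in_filter _ _ pred0) ?filter_pred0 // => q /gt /= pq.
  by apply/negbTE; rewrite -leqNgt (leq_trans lt (ltnW pq)).
congr (_ :: _); apply/esym/all_filterP/allP => q /gt /= pq.
exact: leq_trans lt (ltnW pq).
Qed.

(** * The sweep along rows and columns *)

Section Sweep.
(** Row [r] consists of the columns from [lo r] up to [hi r], the latter excluded. A path at level
    [r] sits on the top edge of a down-pointing triangle of row [r]; [G r k] is the vector of the
    path at column [k], with one coordinate for each possible end. [Fx r] lists the vectors of the
    paths that ended at level [r] or above, and [e r] counts the zigzag edges still to be swept,
    each of which contributes a factor 2. *)
Variables (R : numFieldType) (h w n : nat) (lo hi e : nat -> nat).
Variables (G : nat -> nat -> 'rV[R]_n) (Fx : nat -> seq 'rV[R]_n).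

Definition pointsup r k := ~~ odd (r + k).

(** After the factor 2 for its edge, a vertical lozenge on the zigzag has weight 1 and a path there
    has weight 2. *)
Definition path_weight k : R := if k == 0%N then 2 else 1.

(** The bottom edges that have no triangle of the region below them; this is where paths end. *)
Definition exits r := [seq k <- iota (lo r) (hi r - lo r) | pointsup r k & (k < lo r.+1)%N].

Hypothesis hi_w : forall r, (r < h)%N -> (hi r <= w)%N.
Hypothesis hi_gt0 : forall r, (r < h)%N -> (0 < hi r)%N.
Hypothesis step : forall r k, (r < h)%N -> pointsup r k -> (lo r <= k)%N ->
  (k.+1 < hi r)%N -> G r k.+1 = path_weight k *: G r.+1 k + G r.+1 k.+2.
(** On the left border a path can only step right; on the right border, by [step_hi], the end of the
    missing step has vector zero. *)
Hypothesis step_lo : forall r, (r < h)%N -> ~~ pointsup r (lo r) ->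
  G r (lo r) = G r.+1 (lo r).+1.
Hypothesis step_hi : forall r k, (r < h)%N -> ~~ pointsup r k -> k.+1 = hi r ->
  G r.+1 k.+1 = 0.
(** Coordinate [j] belongs to the end at [k]. It vanishes for the paths already ended and at all
    other edges of level [r.+1], so if no path uses this exit the determinant has a zero column. *)
Hypothesis exitP : forall r k, (r < h)%N -> pointsup r k ->
  (lo r <= k < hi r)%N -> (k < lo r.+1)%N ->
  exists j, (forall u, u \in Fx r -> u 0 j = 0) /\
    (forall p, pointsup r p -> p != k -> G r.+1 p 0 j = 0).
Hypothesis stay : forall r k, (r < h)%N -> pointsup r k ->
  (lo r <= k < hi r)%N -> (lo r.+1 <= k)%N -> (r.+1 < h)%N && (k < hi r.+1)%N.
(** Paths enter the region only from the top of row 0. *)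
Hypothesis lo_down : forall r k, (r.+1 < h)%N -> ~~ pointsup r.+1 k ->
  (lo r.+1 <= k < hi r.+1)%N -> (lo r <= k < hi r)%N.
Hypothesis Fx_exits : forall r, (r < h)%N ->
  Fx r.+1 = Fx r ++ [seq G r.+1 p | p <- exits r].
Hypothesis Fx_last : rows_det (Fx h) = 1.
Hypothesis e_step : forall r, (r < h)%N -> e r = (e r.+1 + ((lo r == 0%N) && ~~ odd r))%N.
Hypothesis e_last : e h = 0%N.

(** The part still to be tiled when the sweep is at column [k] of row [r]. Behind the sweep, a
    down-pointing triangle of row [r.+1] is left exactly if a path has arrived on its top edge, and
    ahead of it in row [r] exactly if a path waits there; the others are covered by vertical
    lozenges. *)
Definition remaining r k (lp lu : seq nat) r' k' :=
  [&& (r' < h)%N, (lo r' <= k' < hi r')%N &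
   [|| (r.+1 < r')%N,
       (r' == r.+1) && [|| pointsup r' k', (k <= k')%N | k' \in lp]
     | [&& r' == r, (k <= k')%N & pointsup r k' || (k' \in lu)]]].

Lemma remaining_window r k lp lu r' k' :
  remaining r k lp lu r' k' -> (r' < h)%N && (k' < w)%N.
Proof.
case/and3P=> hr /andP[_ hk] _; rewrite hr; exact: leq_trans hk (hi_w hr).
Qed.

Let MA r k lp lu := M R (region h w (remaining r k lp lu)).

(* In the row being swept, [k] is the next column; [lp] holds the paths that have *)
(* crossed the row, at level [r.+1], and [lu] those still at level [r].           *)
Record state r k (lp lu : seq nat) : Prop := State {
  st_lo : (lo r <= k)%N;
  st_lp : forall p, p \in lp -> [&& (lo r <= p)%N, (p < k)%N, (p < hi r)%N & pointsup r p];
  st_lps : sorted ltn lp;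
  st_lu : forall p, p \in lu -> [&& (k <= p)%N, (p < hi r)%N & ~~ pointsup r p];
  st_lus : sorted ltn lu;
  st_size : (size (Fx r) + size lp + size lu)%N = n;
  st_exit : forall p, (lo r <= p)%N -> (p < k)%N -> (p < hi r)%N -> pointsup r p ->
    (p < lo r.+1)%N -> p \in lp;
  st_left : k \in lu ->
    (exists2 l, k = l.+1 & l \in lp) \/ G r k = G r.+1 k.+1
}.

Definition state_det r (lp lu : seq nat) :=
  rows_det (Fx r ++ [seq G r.+1 p | p <- lp] ++ [seq G r p | p <- lu]).

Lemma state_det_cons r lp p lu :
  state_det r lp (p :: lu) =
  rows_det ((Fx r ++ [seq G r.+1 p | p <- lp]) ++ G r p :: [seq G r p | p <- lu]).
Proof. by rewrite /state_det /= catA. Qed.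

Lemma state_det_rcons r lp p lu :
  state_det r (rcons lp p) lu =
  rows_det ((Fx r ++ [seq G r.+1 p | p <- lp]) ++ G r.+1 p :: [seq G r p | p <- lu]).
Proof. by rewrite /state_det /= map_rcons cat_rcons -!catA. Qed.

Lemma pointsupS r k : pointsup r k.+1 = ~~ pointsup r k.
Proof. by rewrite /pointsup addnS oddS. Qed.
Lemma pointsupSS r k : pointsup r k.+2 = pointsup r k.
Proof. by rewrite !pointsupS negbK. Qed.
Lemma pointsupSr r k : pointsup r.+1 k = ~~ pointsup r k.
Proof. by rewrite /pointsup addSn oddS. Qed.

Lemma sorted_rcons_lt (s : seq nat) p :
  sorted ltn s -> (forall q, q \in s -> (q < p)%N) -> sorted ltn (rcons s p).
Proof.
case: s => //= q s ps lt; rewrite rcons_path ps /=; apply: lt.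
exact: mem_last.
Qed.

Section Row.
Variable r : nat.
Hypothesis r_lt : (r < h)%N.

(* If no lozenge can leave downwards through the exit edge [k], a path must. *)
Lemma exit_missed k lp us : pointsup r k -> (lo r <= k < hi r)%N -> (k < lo r.+1)%N ->
  (forall p, p \in lp -> pointsup r p && (p < k)%N) ->
  (forall u, u \in us -> (exists2 p, u = G r p & [&& ~~ pointsup r p, (k.+1 < p)%N & (p < hi r)%N])
      \/ exists2 p, u = G r.+1 p & pointsup r p && (k < p)%N) ->
  rows_det (Fx r ++ [seq G r.+1 p | p <- lp] ++ us) = 0.
Proof.
move=> up kin kex lpP usP; have [j [zF zG]] := exitP r_lt up kin kex.
apply: (@rows_det_col0 _ _ _ j) => u; rewrite !mem_cat => /or3P[/zF //|/mapP[p plp ->]|].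
  by have /andP[? ?] := lpP p plp; apply: zG => //; lia.
case/usP => [[p -> /and3P[dn kp ph]]|[p -> /andP[? ?]]]; last by apply: zG => //; lia.
case: p dn kp ph => // q; rewrite pointsupS negbK => upq kq qh.
by rewrite step ?mxE ?zG ?mulr0 ?addr0 ?pointsupSS //; lia.
Qed.

Lemma remaining_skip k lp lu : ~~ pointsup r k -> k \notin lu ->
  MA r k lp lu = MA r k.+1 lp lu.
Proof.
move=> dn knl; congr (M R _); apply: eq_region => r' k' _ _.
have [->|nk] := eqVneq k' k.
  rewrite /remaining (negbTE knl) (negbTE dn); have [->|nr] := eqVneq r' r.+1.
    by rewrite pointsupSr dn.
  by rewrite /= !andbF.
by rewrite /remaining; lia.
Qed.

Lemma remaining_drop k p lp lu : (p < k)%N -> MA r k lp (p :: lu) = MA r k lp lu.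
Proof.
move=> lt; congr (M R _); apply: eq_region => r' k' _ _.
by rewrite /remaining inE; case: (eqVneq k' p) => [->|//]; rewrite (leqNgt k) lt !andbF.
Qed.

(** The left and upper neighbours are gone, so the triangle joins its right neighbour: the path
    steps right. At the right border there is no tiling. *)
Lemma remaining_down k lp lu : ~~ pointsup r k -> (lo r <= k < hi r)%N ->
  (forall p, p \in lp -> (p < k)%N) ->
  MA r k lp (k :: lu) = (k.+1 < hi r)%N%:R * MA r k.+2 (rcons lp k.+1) lu.
Proof.
move=> dn kin lpP; rewrite /MA.
have kF : remaining r k lp (k :: lu) r k.
  by rewrite /remaining r_lt kin eqxx leqnn mem_head !orbT.
rewrite (region_peel (r := r) (k := k) R (@remaining_window _ _ _ _) kF); first last.
- by move=> _ q eq; rewrite /remaining; lia.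
- by move=> l el; rewrite /remaining; lia.
have -> : ~~ odd (r + k) = false by exact: negbTE dn.
rewrite /= mul0r addr0.
have -> : remaining r k lp (k :: lu) r k.+1 = (k.+1 < hi r)%N.
  rewrite /remaining r_lt pointsupS dn eqxx; lia.
congr (_ * M R _); apply: eq_region => r' k' _ _.
rewrite /without /remaining !xpair_eqE mem_rcons !inE.
have := lpP k'; case: (k' \in lp) => [/(_ isT)|_].
  case: (k' \in lu); move: dn; rewrite /pointsup; lia.
case: (k' \in lu); move: dn; rewrite /pointsup; lia.
Qed.

(** Either the path at [k.+1] steps left through this triangle, or a vertical lozenge covers it. *)
Lemma remaining_up k lp lu : pointsup r k -> (lo r <= k < hi r)%N ->
  (forall p, p \in lp -> (p < k)%N) ->
  MA r k lp lu =
    ((k.+1 < hi r)%N && (k.+1 \in lu))%:R * MA r k.+2 (rcons lp k) lu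
    + (lo r.+1 <= k)%N%:R * (vertical_weight R k * MA r k.+1 lp lu).
Proof.
move=> up kin lpP; rewrite /MA.
have kF : remaining r k lp lu r k.
  by rewrite /remaining r_lt kin eqxx leqnn up !orbT.
rewrite (region_peel (r := r) (k := k) R (@remaining_window _ _ _ _) kF); first last.
- by move=> _ q eq; rewrite /remaining; lia.
- by move=> l el; rewrite /remaining; lia.
have -> : remaining r k lp lu r k.+1 = (k.+1 < hi r)%N && (k.+1 \in lu).
  rewrite /remaining r_lt pointsupS up eqxx; case: (_ \in lu); lia.
have -> : ~~ odd (r + k) = true by exact: up.
rewrite andTb.
have -> : remaining r k lp lu r.+1 k = (lo r.+1 <= k)%N.
  have := @stay r k r_lt up kin.
  rewrite /remaining pointsupSr up leqnn eqxx /=; lia.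
congr (_ * _ + _ * (_ * _)); congr (M R _); apply: eq_region => r' k' _ _.
  rewrite /without /remaining !xpair_eqE mem_rcons !inE.
  have := lpP k'; case: (k' \in lp) => [/(_ isT)|_].
    case: (k' \in lu); move: up; rewrite /pointsup; lia.
  case: (k' \in lu); move: up; rewrite /pointsup; lia.
rewrite /without /remaining !xpair_eqE.
have := lpP k'; case: (k' \in lp) => [/(_ isT)|_].
  case: (k' \in lu); move: up; rewrite /pointsup; lia.
case: (k' \in lu); move: up; rewrite /pointsup; lia.
Qed.

Hypothesis next_row : forall lu, sorted ltn lu ->
  (forall p, p \in lu ->
     [&& (r.+1 < h)%N, (lo r.+1 <= p)%N, (p < hi r.+1)%N & ~~ pointsup r.+1 p]) ->
  (size (Fx r.+1) + size lu)%N = n ->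
  2 ^+ e r.+1 * MA r.+1 (lo r.+1) [::] lu =
  rows_det (Fx r.+1 ++ [seq G r.+1 p | p <- lu]).

(** By [st_exit] every exit of the row has been reached, so [lp] is the list of exits followed by
    the paths that go on; the latter are the waiting paths of the next row. *)
Lemma sweep_row_end k lp : state r k lp [::] -> (hi r <= k)%N ->
  2 ^+ e r.+1 * MA r k lp [::] = state_det r lp [::].
Proof.
case=> _ lpP lps _ _ sz ex _ kh.
pose lu := [seq p <- lp | (lo r.+1 <= p)%N].
have lpE : lp = exits r ++ lu.
  rewrite {1}(sorted_ltn_filter (lo r.+1) lps); congr (_ ++ _).
  apply: (irr_sorted_eq ltn_trans ltnn).
  - exact: sorted_filter ltn_trans _ _ lps.
  - by apply: sorted_filter (iota_ltn_sorted _ _); apply: ltn_trans.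
  - move=> p; rewrite !mem_filter mem_iota.
    apply/andP/andP=> [[lt /lpP/and4P[*]]|[/andP[up lt] pin]].
      by split; [apply/andP | lia].
    by split=> //; apply: ex => //; lia.
have luP p : p \in lu ->
     [&& (r.+1 < h)%N, (lo r.+1 <= p)%N, (p < hi r.+1)%N & ~~ pointsup r.+1 p].
  rewrite mem_filter => /andP[le /lpP/and4P[? _ ? up]].
  have /andP[-> ->] : (r.+1 < h)%N && (p < hi r.+1)%N by apply: (@stay r p) => //; lia.
  by rewrite le pointsupSr up.
rewrite /state_det cats0 {2}lpE map_cat catA -Fx_exits // -next_row //.
- congr (_ * _); congr (M R _); apply: eq_region => r' k' _ _.
  have luE : (k' \in lu) = (lo r.+1 <= k')%N && (k' \in lp) by rewrite mem_filter.
  rewrite /remaining luE in_nil !pointsupSr.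
  have := lpP k'; have := @lo_down r.+1 k'; have := @lo_down r k'.
  have [->|ne2] := eqVneq r' r.+2.
    by rewrite pointsupSr /pointsup; case: (k' \in lp); lia.
  have [->|ne1] := eqVneq r' r.+1.
    by rewrite !pointsupSr /pointsup; case: (k' \in lp); lia.
  move=> _ _ _; have [->|ne] := eqVneq r' r; last by lia.
  by case: (k' \in lp); lia.
- exact: sorted_filter ltn_trans _ _ lps.
- by move: sz; rewrite Fx_exits // {1}lpE !size_cat size_map /=; lia.
Qed.

(** Induction on the columns left in the row. Linearity in the vector of the next path expands the
    determinant just as peeling expands [M]; the terms without a tiling have a zero row, a repeated
    row or a zero column. The exponent carries the zigzag edge of this row until column 0 has been
    passed. *)
Lemma sweep_row k lp lu : state r k lp lu ->
  2 ^+ (e r.+1 + ((k == 0%N) && ~~ odd r)) * MA r k lp lu = state_det r lp lu.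
Proof.
have [d] := ubnP (hi r - k); elim: d => // d IH in k lp lu * => lt_d st.
have [kh|kh] := leqP (hi r) k.
  have lu0 : lu = [::].
    case: lu st => // p lu [_ _ _ /(_ p (mem_head _ _))]; lia.
  rewrite lu0 in st *; rewrite -(sweep_row_end st kh).
  by have := hi_gt0 r_lt; case: (k) kh => [|k'] //; [lia | rewrite addn0].
case: (st) => klo lpP lps luP lus sz ex left.
have lpk p : p \in lp -> (p < k)%N by case/lpP/and4P.
have kin : (lo r <= k < hi r)%N by rewrite klo.
case: (boolP (pointsup r k)) => up; last first.
  have -> : (k == 0%N) && ~~ odd r = false.
    by apply/negbTE; move: up; rewrite /pointsup; lia.
  rewrite addn0.
  case: (boolP (k \in lu)) => klu; last first.
    rewrite remaining_skip // -(IH k.+1); [|lia|]; first by rewrite addn0.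
    split=> //; first lia.
    + by move=> p /lpP/and4P[-> lt -> ->]; rewrite ltnS ltnW.
    + move=> p plu; have /and3P[kp -> ->] := luP p plu.
      by rewrite !andbT ltn_neqAle kp andbT; apply: contraNneq klu => ->.
    + move=> p lp1 lp2 lp3 lp4 lp5; apply: ex => //.
      by rewrite ltn_neqAle -ltnS lp2 andbT; apply: contraNneq up => <-.
    + by move=> k1; have /and3P[_ _] := luP _ k1; rewrite pointsupS up.
  have luk p : p \in lu -> (k <= p)%N by case/luP/and3P.
  have [lu' [luE lus' lu'k]] := sorted_ltn_split lus luk klu.
  have lsz : (size (Fx r ++ [seq G r.+1 p | p <- lp]) < n)%N.
    by move: sz; rewrite luE size_cat size_map /=; lia.
  (* A left step would end on the edge [l], which another path occupies, so its term has two equal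
     rows; otherwise the border relation leaves only the right step. *)
  have -> : state_det r lp lu = state_det r (rcons lp k.+1) lu'.
    rewrite luE state_det_cons state_det_rcons.
    case: (left klu) => [[l kl llp]|-> //].
    have /and4P[lol _ _ upl] := lpP l llp.
    rewrite {1}kl step // -?kl // rows_det_linD // rows_det_dup ?mulr0 ?add0r //.
    by rewrite mem_cat map_f // orbT.
  rewrite luE remaining_down //.
  have [k1|k1] := ltnP k.+1 (hi r); last first.
    rewrite mul0r mulr0 state_det_rcons step_hi ?rows_det_row0 //.
    by apply/eqP; rewrite eqn_leq k1 kh.
  rewrite mul1r -(IH k.+2); [|lia|]; first by rewrite addn0.
  split=> //; first lia.
  + move=> p; rewrite mem_rcons inE => /orP[/eqP->|/lpP/and4P[-> lt -> ->]].
      by rewrite leqnn k1 pointsupS up; lia.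
    by rewrite andbT andTb; lia.
  + by apply: sorted_rcons_lt => // p /lpk; lia.
  + move=> p plu; have := luP p; rewrite luE inE plu orbT => /(_ isT)/and3P[_ -> dn].
    have := lu'k p plu; move: dn up; rewrite /pointsup; lia.
  + by move: sz; rewrite size_rcons luE /=; lia.
  + move=> p lp1 lp2 lp3 lp4 lp5; rewrite mem_rcons inE.
    have [->|ne] := eqVneq p k.+1; first by [].
    apply: ex => //; have nk : p != k by apply: contraNneq up => <-.
    lia.
  + by move=> k2; left; exists k.+1; rewrite // mem_rcons mem_head.
have pwE : 2 ^+ (e r.+1 + ((k == 0%N) && ~~ odd r)) = path_weight k * 2 ^+ e r.+1 :> R.
  rewrite /path_weight; case: eqP => [k0|_] /=; last by rewrite addn0 mul1r.
  have -> : ~~ odd r by move: up; rewrite k0 /pointsup addn0.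
  by rewrite addn1 exprS.
have wE : path_weight k * vertical_weight R k = 1.
  rewrite /path_weight /vertical_weight; case: eqP => _; last by rewrite mul1r.
  by rewrite divff // pnatr_eq0.
have knl : k \notin lu by apply: contraL up => /luP/and3P[].
have nk2 : k.+2 \notin lu by apply: contraL up => /luP/and3P[]; rewrite pointsupSS.
rewrite pwE remaining_up //.
case: (boolP (k.+1 \in lu)) => k1lu; last first.
  (* No path can step into [k], so a vertical lozenge covers it; if none fits, [k] is a missed
     exit. *)
  rewrite andbF mul0r add0r; have [lok|lok] := leqP (lo r.+1) k; last first.
    rewrite mul0r mulr0; apply/esym; apply: (exit_missed up kin lok).
      by move=> p /lpP/and4P[_ -> _ ->].
    move=> u /mapP[p plu ->]; left; exists p => //.
    have /and3P[kp -> dn] := luP p plu; rewrite dn andbT /=.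
    have : p != k by apply: contraNneq knl => <-.
    have : p != k.+1 by apply: contraNneq k1lu => <-.
    lia.
  rewrite mul1r mulrA [_ * vertical_weight R k]mulrAC wE mul1r.
  rewrite remaining_skip ?pointsupS ?up //.
  rewrite -(IH k.+2); [|lia|]; first by rewrite addn0.
  split=> //; first lia.
  + by move=> p /lpP/and4P[-> lt -> ->]; rewrite andbT andTb; lia.
  + move=> p plu; have /and3P[kp -> ->] := luP p plu; rewrite andbT andbT.
    have : p != k by apply: contraNneq knl => <-.
    have : p != k.+1 by apply: contraNneq k1lu => <-.
    lia.
  + move=> p lp1 lp2 lp3 lp4 lp5; apply: ex => //.
    have : p != k.+1 by apply: contraTneq lp4 => ->; rewrite pointsupS up.
    lia.
  + by move=> k2; rewrite k2 in nk2.
have luk p : p \in lu -> (k.+1 <= p)%N.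
  move=> plu; have /and3P[kp _ _] := luP p plu.
  by rewrite ltn_neqAle kp andbT; apply: contraNneq knl => ->.
have [lu' [luE lus' lu'k]] := sorted_ltn_split lus luk k1lu.
have lsz : (size (Fx r ++ [seq G r.+1 p | p <- lp]) < n)%N.
  by move: sz; rewrite luE size_cat size_map /=; lia.
have /and3P[_ k1h dn1] := luP _ k1lu.
have lu'P p : p \in lu' -> [&& (k.+2 < p)%N, (p < hi r)%N & ~~ pointsup r p].
  move=> plu; have := luP p; rewrite luE inE plu orbT => /(_ isT)/and3P[_ -> dn].
  rewrite dn !andbT; have := lu'k p plu; have : p != k.+2; last by lia.
  by apply: contraNneq dn => ->; rewrite pointsupSS.
(* The left step of the path at [k.+1] corresponds to the lozenge on columns [k] and [k.+1], the
   right step to the vertical lozenge at [k]. *)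
have -> : state_det r lp lu = path_weight k * state_det r (rcons lp k) lu'
    + state_det r (rcons lp k.+2) lu'.
  by rewrite luE state_det_cons !state_det_rcons step // rows_det_linD.
rewrite k1h mul1r mulrDr; congr (_ + _).
  rewrite luE remaining_drop // -mulrA; congr (_ * _).
  rewrite -(IH k.+2); [|lia|]; first by rewrite addn0.
  split=> //; first lia.
  + move=> p; rewrite mem_rcons inE => /orP[/eqP->|/lpP/and4P[-> lt -> ->]].
      by rewrite klo kh up; lia.
    by rewrite andbT andTb; lia.
  + exact: sorted_rcons_lt.
  + by move=> p /lu'P/and3P[k2p -> ->]; rewrite ltnW.
  + by move: sz; rewrite size_rcons luE /=; lia.
  + move=> p lp1 lp2 lp3 lp4 lp5; rewrite mem_rcons inE.
    have [->|ne] := eqVneq p k; first by [].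
    apply: ex => //; have : p != k.+1 by apply: contraTneq lp4 => ->.
    lia.
  + by move=> /lu'P/and3P[]; rewrite ltnn.
have [lok|lok] := leqP (lo r.+1) k; last first.
  rewrite mul0r mulr0; apply/esym; rewrite /state_det map_rcons cat_rcons.
  apply: (exit_missed up kin lok).
    by move=> p /lpP/and4P[_ -> _ ->].
  move=> u; rewrite inE => /orP[/eqP->|/mapP[p plu ->]].
    by right; exists k.+2 => //; rewrite pointsupSS up; lia.
  left; exists p => //; have /and3P[k2p -> ->] := lu'P p plu; lia.
rewrite mul1r mulrA [_ * vertical_weight R k]mulrAC wE mul1r.
(* The vertical lozenge has removed the left neighbour of [k.+1], so the lozenge to the right is
   forced. *)
rewrite luE remaining_down ?k1h ?andbT //; [|lia|by move=> p /lpk; lia].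
have [k2|k2] := ltnP k.+2 (hi r); last first.
  rewrite mul0r mulr0 state_det_rcons (step_hi (k := k.+1)) ?rows_det_row0 //.
  by apply/eqP; rewrite eqn_leq k2 k1h.
rewrite mul1r -(IH k.+3); [|lia|]; first by rewrite addn0.
split=> //; first lia.
+ move=> p; rewrite mem_rcons inE => /orP[/eqP->|/lpP/and4P[-> lt -> ->]].
    by rewrite pointsupSS up k2; lia.
  by rewrite andbT andTb; lia.
+ by apply: sorted_rcons_lt => // p /lpk; lia.
+ by move: sz; rewrite size_rcons luE /=; lia.
+ move=> p lp1 lp2 lp3 lp4 lp5; rewrite mem_rcons inE.
  have [->|ne] := eqVneq p k.+2; first by [].
  apply: ex => //; have : p != k.+1 by apply: contraTneq lp4 => ->.
  lia.
+ by move=> _; left; exists k.+2; rewrite // mem_rcons mem_head.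
Qed.

End Row.

Lemma sweep r lu : (r <= h)%N -> sorted ltn lu ->
  (forall p, p \in lu ->
     [&& (r < h)%N, (lo r <= p)%N, (p < hi r)%N & ~~ pointsup r p]) ->
  (size (Fx r) + size lu)%N = n ->
  2 ^+ e r * MA r (lo r) [::] lu = rows_det (Fx r ++ [seq G r p | p <- lu]).
Proof.
move=> rh; have [d] := ubnP (h - r); elim: d => // d IH in r rh lu * => lt_d lus luP sz.
have [rh'|rh'] := ltnP r h; last first.
  have {rh rh'} rE : r = h by lia.
  have lu0 : lu = [::] by case: lu {lus sz} luP => // p lu /(_ p (mem_head _ _)); lia.
  rewrite rE lu0 cats0 e_last mul1r Fx_last /MA.
  rewrite (_ : region _ _ _ = set0) ?M_set0 //; apply/setP=> t.
  by rewrite !inE /remaining; lia.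
have {}IH lu' := IH r.+1 rh' lu' _.
have := @sweep_row r rh' _ (lo r) [::] lu.
rewrite -e_step // => -> //.
- by move=> lu' *; apply: IH => //; lia.
- split=> //.
  + by move=> p /luP/and4P[_ -> -> ->].
  + by rewrite addn0.
  + by move=> p; lia.
  + by case/luP/and4P=> _ _ _ dn; right; apply: step_lo.
Qed.

Theorem sweep_region lu : sorted ltn lu ->
  (forall p, (p \in lu) =
     [&& (0 < h)%N, (lo 0 <= p)%N, (p < hi 0)%N & ~~ pointsup 0 p]) ->
  (size (Fx 0) + size lu)%N = n ->
  2 ^+ e 0 * M R (region h w (fun r k => (lo r <= k < hi r)%N)) =
  rows_det (Fx 0 ++ [seq G 0 p | p <- lu]).
Proof.
move=> lus luP sz; rewrite -sweep //; last by move=> p; rewrite luP.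
congr (_ * _); congr (M R _); apply: eq_region => r k rh _.
rewrite /remaining luP rh in_nil /=; case: r rh => [|[|r]] rh.
- by rewrite rh /pointsup; lia.
- by have := @lo_down 0 k rh; rewrite /pointsup; lia.
- by lia.
Qed.
End Sweep.

(** * Folded walks and paths *)

Fixpoint walks (s : nat) (d : int) : nat :=
  if s is s'.+1 then (walks s' (d - 1) + walks s' (d + 1))%N else (d == 0).

Lemma walks_out s d : s%:Z < `|d| -> walks s d = 0%N.
Proof.
elim: s d => [|s IH] d /= lt; first by case: eqP lt => // ->.
by rewrite !IH //; lia.
Qed.

Lemma walks_bin s k : walks s (s%:Z - (2 * k)%:Z) = 'C(s, k).
Proof.
elim: s k => [|s IH] k /=; first by rewrite bin0n; case: k => //= k; lia.
case: k => [|k].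
  have -> : s.+1%:Z - (2 * 0)%:Z - 1 = s%:Z - (2 * 0)%:Z by lia.
  by rewrite IH !bin0 walks_out //; lia.
rewrite binS -!IH; congr (walks _ _ + walks _ _)%N; lia.
Qed.

(* Walks on the half-line from [(k, y)] to [(X, Y)], a visit to [0] counting twice *)
(* except at the start; these are the walks on the line folded at [0].             *)
Definition folded (Y X y k : nat) : nat :=
  if (Y < y)%N then 0%N
  else if k == 0%N then walks (Y - y) X%:Z
  else (walks (Y - y) (X%:Z - k%:Z) + walks (Y - y) (X%:Z + k%:Z))%N.

(** Unfolded, a walk ends at [X] or [-X]. At column 0 both choices coincide and [folded] counts them
    once, whence the factor 2. The hypothesis excludes the end itself, where the left side is 1 and
    the right side 0. *)
Lemma folded_step Y X y k : (y != Y) || (k.+1 != X) ->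
  folded Y X y k.+1 =
  ((if k == 0%N then 2 else 1) * folded Y X y.+1 k + folded Y X y.+1 k.+2)%N.
Proof.
rewrite /folded; case: (ltngtP y Y) => [lt|lt|->] /=.
- move=> _; rewrite ltnNge lt /=; have -> : (Y - y = (Y - y.+1).+1)%N by lia.
  rewrite /=; set s := (Y - y.+1)%N.
  have E1 : X%:Z - k.+1%:Z - 1 = X%:Z - k.+2%:Z by lia.
  have E2 : X%:Z - k.+1%:Z + 1 = X%:Z - k%:Z by lia.
  have E3 : X%:Z + k.+1%:Z - 1 = X%:Z + k%:Z by lia.
  have E4 : X%:Z + k.+1%:Z + 1 = X%:Z + k.+2%:Z by lia.
  rewrite E1 E2 E3 E4; case: eqP => [->|_]; last by lia.
  by rewrite !subr0; lia.
- by move=> _; rewrite (ltnS Y) (ltnW lt) muln0.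
- by rewrite ltnSn muln0 => ne; rewrite subnn /=; lia.
Qed.

Lemma folded_step0 Y X y : (y < Y)%N || (0 < X)%N -> folded Y X y 0 = folded Y X y.+1 1.
Proof.
rewrite /folded; case: (ltngtP y Y) => [lt|lt|->] /=.
- by move=> _; rewrite ltnNge lt /=; have -> : (Y - y = (Y - y.+1).+1)%N by lia.
- by move=> _; rewrite (ltnS Y) (ltnW lt).
- by rewrite ltnSn subnn /=; lia.
Qed.

Lemma folded_out Y X y k : (Y + k < y + X)%N || (Y + X < y + k)%N -> folded Y X y k = 0%N.
Proof.
rewrite /folded => lt; case: ltnP => // le; case: eqP => [k0|_]; rewrite !walks_out //; lia.
Qed.

Lemma folded_end Y X k : (0 < X)%N -> folded Y X Y k = (k == X).
Proof. by rewrite /folded ltnn subnn /=; case: eqP => [->|]; lia. Qed.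

Lemma folded_late Y X y k : (Y < y)%N -> folded Y X y k = 0%N.
Proof. by rewrite /folded => ->. Qed.

Definition dents (a : nat) := [seq (2 * j + 1)%N | j <- iota 0 a].
Definition south_edges (x b : nat) := [seq (b + 1 + 2 * j)%N | j <- iota 0 x].

Lemma mem_dents a k : (k \in dents a) = odd k && (k < 2 * a)%N.
Proof.
apply/mapP/idP=> [[j]|ok]; first by rewrite mem_iota => ? ->; lia.
by exists k./2; rewrite ?mem_iota; lia.
Qed.

Lemma mem_south_edges x b k :
  (k \in south_edges x b) = [&& odd (b + k), (b < k)%N & (k < b + 2 * x + 1)%N].
Proof.
apply/mapP/idP=> [[j]|ok]; first by rewrite mem_iota => ? ->; lia.
by exists (k - b)./2; rewrite ?mem_iota; lia.
Qed.

Lemma sorted_dents a : sorted ltn (dents a).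
Proof.
rewrite /dents sorted_map; apply: sub_sorted (iota_ltn_sorted 0 a) => i j /=; lia.
Qed.

Lemma sorted_south_edges x b : sorted ltn (south_edges x b).
Proof.
rewrite /south_edges sorted_map; apply: sub_sorted (iota_ltn_sorted 0 x) => i j /=; lia.
Qed.

(** * Path vectors and their ends *)

Section Paths.
Variables (R : numFieldType) (x a b c : nat).
Let h := (2 * a + b + 2 * c)%N.

Definition dent_paths (y k : nat) : 'rV[R]_a :=
  \row_(j < a) (folded (2 * c) (2 * j + 1) y k)%:R.

Definition south_paths (y k : nat) : 'rV[R]_x :=
  \row_(j < x) (folded (2 * a + b + 2 * c) (b + 1 + 2 * j) y k)%:R.

Definition paths (y k : nat) : 'rV[R]_(a + x) := row_mx (dent_paths y k) (south_paths y k).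

Definition dent_to_south : 'M[R]_(a, x) :=
  \matrix_(j < a) south_paths (2 * c)%N (2 * j + 1)%N.

(* After this column operation the paths that reach a dent edge have no southern *)
(* coordinates, as if they stopped there.                                        *)
Definition absorb : 'M[R]_(a + x) := block_mx 1%:M (- dent_to_south) 0 1%:M.

Definition absorbed (y k : nat) := paths y k *m absorb.

Lemma det_absorb : \det absorb = 1.
Proof. by rewrite /absorb det_ublock !det1 mulr1. Qed.

Lemma absorbedE y k :
  absorbed y k = row_mx (dent_paths y k) (south_paths y k - dent_paths y k *m dent_to_south).
Proof.
by rewrite /absorbed mul_row_block mulmx1 mulmx0 addr0 mulmx1 mulmxN addrC.
Qed.

(** The recursion breaks only at ends: the dent edges at level [2 * c] are excluded explicitly, the
    southern ones by [y < h]. *)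
Lemma paths_step y k : (y < h)%N ->
  (y != 2 * c)%N || (2 * a <= k)%N ->
  paths y k.+1 = path_weight R k *: paths y.+1 k + paths y.+1 k.+2.
Proof.
move=> yh yk; rewrite /paths scale_row_mx add_row_mx.
have pw : path_weight R k = (if k == 0%N then 2 else 1)%N%:R.
  by rewrite /path_weight; case: ifP.
congr row_mx; apply/rowP=> j; rewrite !mxE pw folded_step ?natrD ?natrM //.
- by have := ltn_ord j; lia.
- by rewrite ltn_eqF.
Qed.

Lemma dent_paths_late y k : (2 * c < y)%N -> dent_paths y k = 0.
Proof. by move=> lt; apply/rowP=> j; rewrite !mxE folded_late. Qed.

Lemma absorbed_step y k : (y < h)%N ->
  (y != 2 * c)%N || (2 * a <= k)%N ->
  absorbed y k.+1 = path_weight R k *: absorbed y.+1 k + absorbed y.+1 k.+2.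
Proof. by move=> yh yk; rewrite /absorbed paths_step // mulmxDl scalemxAl. Qed.

Lemma absorbed_step0 y : (y < 2 * c)%N -> absorbed y 0 = absorbed y.+1 1.
Proof.
move=> lt; rewrite /absorbed /paths; congr (row_mx _ _ *m _).
all: by apply/rowP=> j; rewrite !mxE folded_step0 //; lia.
Qed.

Lemma absorbed_out y k : (2 * c < y)%N || (2 * c + 2 * a <= y + k)%N ->
  (forall j, (j < x)%N ->
    (h + k < y + (b + 1 + 2 * j))%N || (h + (b + 1 + 2 * j) < y + k)%N) -> absorbed y k = 0.
Proof.
move=> yc out; rewrite /absorbed /paths.
have -> : dent_paths y k = 0.
  apply/rowP=> j; rewrite !mxE; case: (ltnP (2 * c) y) => [lt|le].
    by rewrite folded_late.
  by rewrite folded_out //; have := ltn_ord j; lia.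
have -> : south_paths y k = 0.
  by apply/rowP=> j; rewrite !mxE folded_out // out.
by rewrite row_mx0 mul0mx.
Qed.

Lemma dent_paths_end j : dent_paths (2 * c)%N j = \row_(i < a) (j == 2 * i + 1)%N%:R.
Proof. by apply/rowP=> i; rewrite !mxE folded_end // addn1. Qed.

(** By the choice of [dent_to_south] the southern coordinates cancel. *)
Lemma absorbed_dent (j : 'I_a) : absorbed (2 * c)%N (2 * j + 1)%N = row_mx (delta_mx 0 j) 0.
Proof.
have dE : dent_paths (2 * c)%N (2 * j + 1)%N = delta_mx 0 j.
  rewrite dent_paths_end; apply/rowP=> i; rewrite !mxE eqxx /=.
  by rewrite -val_eqE /=; congr (_%:R); lia.
rewrite absorbedE dE -rowE; congr row_mx.
by apply/rowP=> i; rewrite !mxE subrr.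
Qed.

Lemma south_paths_end j :
  south_paths h j = \row_(i < x) (j == b + 1 + 2 * i)%N%:R.
Proof. by apply/rowP=> i; rewrite !mxE folded_end // addn1. Qed.

Lemma dent_paths_last k : dent_paths h k = 0 \/ a = 0%N.
Proof.
have [a0|a0] := posnP a; [by right | left].
by apply: dent_paths_late; rewrite /h; lia.
Qed.

Lemma absorbed_last k : absorbed h k = row_mx (dent_paths h k) (south_paths h k).
Proof.
rewrite absorbedE; congr row_mx; rewrite -[RHS]subr0; congr (_ - _).
apply/rowP=> i; rewrite !mxE big1 // => j _.
by case: (dent_paths_last k) => [->|a0]; [rewrite mxE mul0r | case: j => /=; lia].
Qed.

Lemma rows_det_ends :
  rows_det ([seq absorbed (2 * c)%N k | k <- dents a] ++ [seq absorbed h k | k <- south_edges x b]) = 1.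
Proof.
rewrite /rows_det; rewrite (_ : \matrix_i _ = 1%:M) ?det1 //.
apply/row_matrixP=> i; rewrite rowK row1.
case: (splitP i) => j ij.
  rewrite nth_cat !size_map size_iota ij ltn_ord.
  rewrite (nth_map 0%N) ?size_map ?size_iota // (nth_map 0%N) ?size_iota // nth_iota // add0n.
  rewrite absorbed_dent; apply/rowP=> k; rewrite !mxE; case: splitP => l kl.
    by rewrite !mxE -!val_eqE /= kl ij.
  rewrite mxE -!val_eqE /= kl ij; case: eqP => //; have := ltn_ord j; lia.
rewrite nth_cat !size_map size_iota ij ltnNge leq_addr /= addKn.
rewrite (nth_map 0%N) ?size_map ?size_iota // (nth_map 0%N) ?size_iota // nth_iota // add0n.
rewrite absorbed_last south_paths_end; apply/rowP=> k; rewrite !mxE; case: splitP => l kl.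
  case: (dent_paths_last (b + 1 + 2 * j)%N) => [->|a0]; last by case: l kl => /=; lia.
  by rewrite mxE -!val_eqE /= kl ij; case: eqP => //; have := ltn_ord l; lia.
by rewrite mxE -!val_eqE /= kl ij; congr (_%:R); lia.
Qed.
End Paths.

(** * The regions [B'] and [P'] *)

Lemma rows_det_absorbed (R : numFieldType) (x a b c y : nat) (s : seq nat) :
  rows_det [seq absorbed R x a b c y k | k <- s] =
  rows_det [seq paths R x a b c y k | k <- s].
Proof.
rewrite -[RHS]mulr1 -(det_absorb R x a b c) -rows_detM -map_comp.
by congr rows_det; apply: eq_map.
Qed.

Lemma iota_odd_split (a x : nat) :
  [seq (2 * j + 1)%N | j <- iota 0 (a + x)] =
  dents a ++ [seq (2 * a + 2 * j + 1)%N | j <- iota 0 x].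
Proof.
rewrite iotaD map_cat add0n /dents; congr (_ ++ _).
rewrite -{1}[a]addn0 iotaDl -map_comp.
by apply: eq_map => j /=; rewrite mulnDr.
Qed.

Section RegionB.
Variables (R : numFieldType) (x a b c : nat).
Let h := (2 * a + b + 2 * c)%N.
Let w := (2 * (x + a) + (b + c))%N.
Let G := absorbed R x a b c.

(* Past the last row every edge counts as an exit. *)
Definition B_lo r : nat :=
  (if r < 2 * c then 0
   else if r < 2 * c + 2 * a then 2 * (a + c) - r
   else if r < 2 * a + b + 2 * c then (r - 2 * (a + c)).+1
   else (2 * (x + a + b + c)).+2)%N.

Definition B_hi r : nat :=
  (if r < b + c then (2 * (x + a) + r).+1 else 2 * (x + a + b + c) - r)%N.

Definition B_fixed r : seq 'rV[R]_(a + x) :=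
  (if (r < 2 * c)%N then [::] else [seq G (2 * c)%N k | k <- dents a]) ++
  (if (r < 2 * a + b + 2 * c)%N then [::]
   else [seq G (2 * a + b + 2 * c)%N k | k <- south_edges x b]).

Lemma B_loP r :
  [\/ (r < 2 * c)%N /\ B_lo r = 0%N,
      (2 * c <= r < 2 * c + 2 * a)%N /\ B_lo r = (2 * (a + c) - r)%N,
      (2 * c + 2 * a <= r < 2 * a + b + 2 * c)%N /\ B_lo r = (r - 2 * (a + c)).+1%N
    | (2 * a + b + 2 * c <= r)%N /\ B_lo r = (2 * (x + a + b + c)).+2%N].
Proof.
rewrite /B_lo; case: ltnP => r1; first by constructor 1.
case: ltnP => r2; first by constructor 2.
by case: ltnP => r3; [constructor 3 | constructor 4].
Qed.

Lemma B_hiP r :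
  ((r < b + c)%N /\ B_hi r = (2 * (x + a) + r).+1%N) \/
  ((b + c <= r)%N /\ B_hi r = (2 * (x + a + b + c) - r)%N).
Proof. by rewrite /B_hi; case: ltnP; [left | right]. Qed.

Lemma B_region : B' x a b c = region h w (fun r k => (B_lo r <= k < B_hi r)%N).
Proof.
apply/setP=> t; rewrite !inE /tri_corners /corners.
have rh : (row_of t < h)%N by rewrite /row_of.
move: (row_of t) (col_of t) rh => r k rh; rewrite /h in rh.
by case: (boolP (odd (r + k))) => o /=; case: (B_loP r) => -[? ?]; case: (B_hiP r) => -[? ?]; lia.
Qed.

Lemma exits_B r : (r < h)%N ->
  exits B_lo B_hi r = (if r.+1 == 2 * c then dents a else [::])%N ++
     (if r.+1 == h then south_edges x b else [::]).
Proof.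
move=> rh; apply: (irr_sorted_eq ltn_trans ltnn).
- by apply: sorted_filter (iota_ltn_sorted _ _); apply: ltn_trans.
- case: eqP => e1; case: eqP => e2; rewrite ?cats0 ?cat0s //.
  (* If both rows coincide then [2 * a + b = 0], so there are no dent edges. *)
  + rewrite (_ : dents a = [::]) ?sorted_south_edges // /dents (_ : a = 0%N) //.
    by rewrite /h in rh e2; lia.
  + exact: sorted_dents.
  + exact: sorted_south_edges.
- move=> k; rewrite mem_filter mem_iota mem_cat /pointsup.
  case: (eqVneq r.+1 (2 * c)%N) => e1; case: (eqVneq r.+1 h) => e2.
  all: rewrite ?mem_dents ?mem_south_edges ?(in_nil k).
  all:     case: (B_loP r) => -[? ?]; case: (B_loP r.+1) => -[? ?]; case: (B_hiP r) => -[? ?]; rewrite /h in rh e2 *; lia.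
Qed.

Lemma B_fixed_exits r : (r < h)%N ->
  B_fixed r.+1 = B_fixed r ++ [seq G r.+1 p | p <- exits B_lo B_hi r].
Proof.
move=> rh; rewrite exits_B // /B_fixed -/h rh cats0 map_cat.
have [e1|n1] := eqVneq r.+1 (2 * c)%N.
  rewrite -e1 ltnn ltnSn; case: eqVneq => [->|n2]; first by rewrite ltnn.
  by rewrite ltn_neqAle n2 rh.
have -> : (r.+1 < 2 * c)%N = (r < 2 * c)%N by lia.
rewrite cat0s; congr (_ ++ _); case: eqVneq => [->|n2]; first by rewrite ltnn.
by rewrite ltn_neqAle n2 rh.
Qed.

Lemma B_exit r k : (r < h)%N -> pointsup r k -> (B_lo r <= k < B_hi r)%N ->
  (k < B_lo r.+1)%N ->
  exists j, (forall u, u \in B_fixed r -> u 0 j = 0) /\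
    (forall p, pointsup r p -> p != k -> G r.+1 p 0 j = 0).
Proof.
move=> rh up kin kex.
have : k \in exits B_lo B_hi r by rewrite mem_filter mem_iota up kex; lia.
rewrite exits_B // mem_cat /B_fixed -/h rh cats0 => /orP[].
  case: eqP => // e1 /mapP[j]; rewrite mem_iota => jP kE.
  have ja : (j < a)%N by lia.
  exists (lshift x (Ordinal ja)); rewrite -e1 ltnSn; split=> // p _ pk.
  rewrite /G absorbedE row_mxEl e1 dent_paths_end mxE /= -kE.
  by rewrite (negbTE pk).
case: eqP => // e2 /mapP[j]; rewrite mem_iota => jP kE.
have jx : (j < x)%N by lia.
exists (rshift a (Ordinal jx)); split=> [u|p _ pk].
  case: ifP => // _ /mapP[d]; rewrite mem_dents => dP ->.
  have da : (d./2 < a)%N by lia.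
  have -> : d = (2 * Ordinal da + 1)%N by rewrite /=; lia.
  by rewrite /G absorbed_dent row_mxEr mxE.
by rewrite e2 /G absorbed_last row_mxEr south_paths_end mxE /= -kE (negbTE pk).
Qed.

Theorem B_paths :
  2 ^+ c * M R (B' x a b c) =
  rows_det [seq paths R x a b c 0 (2 * j + 1)%N | j <- iota 0 (a + x)].
Proof.
pose lu := [seq k <- iota (B_lo 0) (B_hi 0 - B_lo 0) | (0 < h)%N && ~~ pointsup 0 k].
rewrite (map_comp (paths R x a b c 0) (fun j => 2 * j + 1)%N) -rows_det_absorbed.
have seqE : [seq absorbed R x a b c 0 k | k <- [seq (2 * j + 1)%N | j <- iota 0 (a + x)]]
   = B_fixed 0 ++ [seq G 0 k | k <- lu].
  rewrite /B_fixed -/h /G.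
  (* For [c = 0] the dent touches the northern side: the first [a] paths end where they start and
     are already in [B_fixed 0]. *)
  have [c0|c0] := posnP c; last first.
    have -> : (0 < 2 * c)%N by lia.
    have h0 : (0 < h)%N by rewrite /h; lia.
    rewrite h0 /=; congr map; apply: (irr_sorted_eq ltn_trans ltnn).
    - exact: sorted_dents.
    - by apply: sorted_filter (iota_ltn_sorted _ _); apply: ltn_trans.
    - move=> k; rewrite mem_filter mem_iota h0 (mem_dents (a + x)) /pointsup.
      case: (B_loP 0) => -[? ->]; case: (B_hiP 0) => -[? ->]; rewrite /h in h0; lia.
  rewrite iota_odd_split map_cat c0 muln0 ltnn /= -catA; congr (_ ++ _).
  have [h0|h0] := posnP h.
    have [a0 b0] : a = 0%N /\ b = 0%N by rewrite /h in h0; lia.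
    rewrite /lu h0 /= (eq_filter (a2 := pred0)) // filter_pred0 cats0.
    by congr map; rewrite /south_edges; apply: eq_map => j; rewrite a0 b0; lia.
  rewrite cat0s; congr map; apply: (irr_sorted_eq ltn_trans ltnn).
  - rewrite sorted_map; apply: sub_sorted (iota_ltn_sorted 0 x) => i j /=; lia.
  - by apply: sorted_filter (iota_ltn_sorted _ _); apply: ltn_trans.
  - move=> k; rewrite mem_filter mem_iota h0 /pointsup.
    rewrite (_ : (k \in _) = [&& odd k, (2 * a <= k)%N & (k < 2 * a + 2 * x)%N]).
      case: (B_loP 0) => -[? ->]; case: (B_hiP 0) => -[? ->]; rewrite /h in h0; lia.
    apply/mapP/idP=> [[j]|ok]; first by rewrite mem_iota => ? ->; lia.
    by exists (k - 2 * a)./2; rewrite ?mem_iota; lia.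
(* The exponent [c - (r.+1)./2] counts the even rows from [r] to [2 * c - 1], which are those whose
   zigzag edge is still ahead. *)
rewrite seqE B_region -[c in 2 ^+ c](_ : (c - (0.+1)./2)%N = c); last by rewrite subn0.
apply: (@sweep_region R h w (a + x) B_lo B_hi (fun r => c - (r.+1)./2)%N G B_fixed).
- by move=> r rh; rewrite /w; rewrite /h in rh; case: (B_hiP r) => -[? ?]; lia.
- by move=> r rh; rewrite /h in rh; case: (B_hiP r) => -[? ?]; lia.
- move=> r k rh up kl kh; apply: absorbed_step => //.
  by rewrite /pointsup in up; case: (B_loP r) => -[? ?]; rewrite /h in rh *; lia.
- move=> r rh; rewrite /pointsup; case: (B_loP r) => -[rc ->] dn.
  + by rewrite /G absorbed_step0.
  + by rewrite /h in rh; lia.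
  (* Along the southwestern side the left step leads out of reach of all southern edges, so its
     vector is zero. *)
  + rewrite /G absorbed_step //; last by lia.
    rewrite [absorbed _ _ _ _ _ _ (r - _)]absorbed_out ?scaler0 ?add0r //; first by lia.
    by move=> j jx; rewrite /h in rh *; lia.
  + by rewrite /h in rh; lia.
- move=> r k rh dn kE; apply: absorbed_out.
    by case: (B_hiP r) kE => -[? ->] ?; rewrite /h in rh; rewrite /pointsup in dn; lia.
  by move=> j jx; case: (B_hiP r) kE => -[? ->] ?; rewrite /h in rh *; rewrite /pointsup in dn; lia.
- exact: B_exit.
- move=> r k rh up kin kl; rewrite /pointsup in up.
  by case: (B_loP r) => -[? ?]; case: (B_loP r.+1) => -[? ?]; case: (B_hiP r) => -[? ?]; case: (B_hiP r.+1) => -[? ?]; rewrite /h in rh *; lia.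
- move=> r k rh dn kin; rewrite /pointsup in dn.
  by case: (B_loP r) => -[? ?]; case: (B_loP r.+1) => -[? ?]; case: (B_hiP r) => -[? ?]; case: (B_hiP r.+1) => -[? ?]; rewrite /h in rh *; lia.
- exact: B_fixed_exits.
- rewrite /B_fixed ltnn ifN; first exact: rows_det_ends.
  by rewrite -leqNgt /h; lia.
- by move=> r rh; case: (B_loP r) => -[? ?]; rewrite /h in rh *; lia.
- by rewrite /h; lia.
- by apply: sorted_filter (iota_ltn_sorted _ _); apply: ltn_trans.
- move=> p; rewrite mem_filter mem_iota; lia.
- have := congr1 size seqE.
  by rewrite size_cat !size_map size_iota => <-.
Qed.
End RegionB.

Section RegionP.
Variables (R : numFieldType) (a b c : nat).
Let h := (c + c)%N.
Let w := (2 * a + c)%N.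
Let G := absorbed R 0 a b c.

Definition P_lo r : nat := (if r < c + c then 0 else (2 * (a + c)).+2)%N.

Definition P_hi r : nat := (if r < c then (2 * a + r).+1 else 2 * (a + c) - r)%N.

Definition P_fixed r : seq 'rV[R]_(a + 0) :=
  if (r < c + c)%N then [::] else [seq G (2 * c)%N k | k <- dents a].

Lemma P_loP r :
  ((r < c + c)%N /\ P_lo r = 0%N) \/ ((c + c <= r)%N /\ P_lo r = (2 * (a + c)).+2%N).
Proof. by rewrite /P_lo; case: ltnP; [left | right]. Qed.

Lemma P_hiP r :
  ((r < c)%N /\ P_hi r = (2 * a + r).+1%N) \/ ((c <= r)%N /\ P_hi r = (2 * (a + c) - r)%N).
Proof. by rewrite /P_hi; case: ltnP; [left | right]. Qed.

Lemma P_region : P' c c a = region h w (fun r k => (P_lo r <= k < P_hi r)%N).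
Proof.
apply/setP=> t; rewrite !inE /tri_corners /corners.
have rh : (row_of t < h)%N by rewrite /row_of.
move: (row_of t) (col_of t) rh => r k rh; rewrite /h in rh.
by case: (boolP (odd (r + k))) => o /=; case: (P_loP r) => -[? ?]; case: (P_hiP r) => -[? ?]; lia.
Qed.

Lemma exits_P r : (r < h)%N ->
  exits P_lo P_hi r = if r.+1 == h then dents a else [::].
Proof.
move=> rh; apply: (irr_sorted_eq ltn_trans ltnn).
- by apply: sorted_filter (iota_ltn_sorted _ _); apply: ltn_trans.
- by case: eqP => e1 //; apply: sorted_dents.
- move=> k; rewrite mem_filter mem_iota /pointsup.
  case: (eqVneq r.+1 h) => e1; rewrite ?mem_dents ?(in_nil k).
  all: case: (P_loP r) => -[? ?]; case: (P_loP r.+1) => -[? ?]; case: (P_hiP r) => -[? ?].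
  all: by rewrite /h in rh e1; lia.
Qed.

(** The southern side of this region carries exactly the [a] dent edges, so the determinant is that
    of [B_paths] for [x = 0]. *)
Theorem P_paths :
  2 ^+ c * M R (P' c c a) =
  rows_det [seq paths R 0 a b c 0 (2 * j + 1)%N | j <- iota 0 (a + 0)].
Proof.
pose lu := [seq k <- iota (P_lo 0) (P_hi 0 - P_lo 0) | (0 < h)%N && ~~ pointsup 0 k].
rewrite (map_comp (paths R 0 a b c 0) (fun j => 2 * j + 1)%N) -rows_det_absorbed.
have seqE : [seq absorbed R 0 a b c 0 k | k <- [seq (2 * j + 1)%N | j <- iota 0 (a + 0)]]
   = P_fixed 0 ++ [seq G 0 k | k <- lu].
  rewrite /P_fixed -/h /G; have [h0|h0] := posnP h.
    have c0 : c = 0%N by rewrite /h in h0; lia.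
    rewrite /lu h0 /= (eq_filter (a2 := pred0)) // filter_pred0 cats0 c0 muln0.
    by congr map; rewrite /dents addn0.
  rewrite cat0s; congr map; apply: (irr_sorted_eq ltn_trans ltnn).
  - exact: sorted_dents.
  - by apply: sorted_filter (iota_ltn_sorted _ _); apply: ltn_trans.
  - move=> k; rewrite mem_filter mem_iota h0 (mem_dents (a + 0)) /pointsup.
    by case: (P_loP 0) => -[? ->]; case: (P_hiP 0) => -[? ->]; rewrite /h in h0; lia.
rewrite seqE P_region -[c in 2 ^+ c](_ : (c - (0.+1)./2)%N = c); last by rewrite subn0.
have hE : h = (2 * c)%N by rewrite /h; lia.
apply: (@sweep_region R h w (a + 0) P_lo P_hi (fun r => c - (r.+1)./2)%N G P_fixed).
- by move=> r rh; rewrite /w; rewrite /h in rh; case: (P_hiP r) => -[? ?]; lia.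
- by move=> r rh; rewrite /h in rh; case: (P_hiP r) => -[? ?]; lia.
- by move=> r k rh up kl kh; apply: absorbed_step; rewrite /h in rh; lia.
- move=> r rh dn; case: (P_loP r) => -[? ->]; rewrite /h in rh; last by lia.
  by rewrite /G absorbed_step0 //; lia.
- move=> r k rh dn kE; apply: absorbed_out => //.
  by case: (P_hiP r) kE => -[? ->] ?; rewrite /h in rh; rewrite /pointsup in dn; lia.
- move=> r k rh up kin kex.
  have : k \in exits P_lo P_hi r by rewrite mem_filter mem_iota up kex; lia.
  rewrite exits_P // /P_fixed -/h rh; case: eqP => // e1 /mapP[j]; rewrite mem_iota => jP kE.
  have ja : (j < a)%N by lia.
  exists (lshift 0 (Ordinal ja)); split=> // p _ pk.
  by rewrite /G absorbedE row_mxEl e1 hE dent_paths_end mxE /= -kE (negbTE pk).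
- move=> r k rh up kin kl; rewrite /pointsup in up.
  by case: (P_loP r) => -[? ?]; case: (P_loP r.+1) => -[? ?]; case: (P_hiP r) => -[? ?];
    case: (P_hiP r.+1) => -[? ?]; rewrite /h in rh *; lia.
- move=> r k rh dn kin; rewrite /pointsup in dn.
  by case: (P_loP r) => -[? ?]; case: (P_loP r.+1) => -[? ?]; case: (P_hiP r) => -[? ?];
    case: (P_hiP r.+1) => -[? ?]; rewrite /h in rh *; lia.
- move=> r rh; rewrite exits_P // /P_fixed -/h rh; case: eqVneq => [->|ne].
    by rewrite ltnn hE.
  by rewrite ltn_neqAle ne rh.
- rewrite /P_fixed ltnn; have := rows_det_ends R 0 a b c.
  by rewrite /south_edges /= cats0.
- by move=> r rh; case: (P_loP r) => -[? ?]; rewrite /h in rh *; lia.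
- by rewrite /h; lia.
- by apply: sorted_filter (iota_ltn_sorted _ _); apply: ltn_trans.
- by move=> p; rewrite mem_filter mem_iota; lia.
- have := congr1 size seqE.
  by rewrite size_cat !size_map size_iota => <-.
Qed.
End RegionP.

(** * Determinants of rising factorials *)

Lemma walks_add n s d :
  walks (n + s) d = (\sum_(l < n.+1) 'C(n, l) * walks s (d - n%:Z + (2 * l)%:Z)%R)%N.
Proof.
elim: n d => [|n IH] d /=.
  by rewrite big_ord_recl big_ord0 /= mul1n addn0 subr0 addr0.
rewrite !IH [in RHS]big_ord_recl /= bin0 mul1n.
under [in RHS]eq_bigr => l _ do rewrite /bump /= ?add1n binS mulnDl.
rewrite big_split /= addnA; congr (_ + _)%N; last first.
  by apply: eq_bigr => l _; congr (_ * walks _ _)%N; lia.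
rewrite [in LHS]big_ord_recl /= bin0 mul1n; congr (walks _ _ + _)%N; first by lia.
rewrite [in RHS]big_ord_recr /= bin_small // mul0n addn0.
by apply: eq_bigr => l _; rewrite /bump /= ?add1n; congr (_ * walks _ _)%N; lia.
Qed.

(** A walk from [l], starting [2 * i + 1] levels above the northern side, crosses it at [2 * t + 1]
    or at the mirror image; both are reached equally often and together give one folded count. Thus
    a unitriangular combination of the rows of path numbers is a row of single walk numbers, that
    is, of binomial coefficients. *)
Lemma walks_fold i Y X :
  walks ((2 * i).+1 + Y) X%:Z =
  (\sum_(t < i.+1) 'C((2 * i).+1, i - t) * folded Y X 0 (2 * t + 1))%N.
Proof.
rewrite walks_add (_ : (2 * i).+2 = i.+1 + i.+1)%N; last by lia.
rewrite big_split_ord /= (reindex_inj rev_ord_inj) -big_split /=.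
apply: eq_bigr => t _; have := ltn_ord t => lt.
rewrite subSS (_ : 'C(_, i.+1 + t) = 'C((2 * i).+1, i - t)); last first.
  by rewrite -bin_sub; [congr 'C(_, _) |]; lia.
rewrite -mulnDr; congr (_ * _)%N; rewrite /folded /= addn1 /= subn0.
by congr (walks _ _ + walks _ _)%N; lia.
Qed.

Lemma det_rev (R : comPzRingType) n (A : 'M[R]_n) :
  \det (\matrix_(i, j) A (rev_ord i) (rev_ord j)) = \det A.
Proof.
pose s := perm (@rev_ord_inj n).
have -> : (\matrix_(i, j) A (rev_ord i) (rev_ord j)) = row_perm s (col_perm s A).
  by apply/matrixP=> i j; rewrite !mxE !permE.
rewrite row_permE col_permE !det_mulmx !det_perm odd_permV mulrCA mulrA.
by rewrite -mulrA -signr_addb addbb mulr1.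
Qed.

Section Determinants.
Variable R : numFieldType.

Definition rising (y : R) n := \prod_(i < n) (y + i%:R).

Definition rising_poly (s : R) n : {poly R} := \prod_(i < n) ('X + (s + i%:R)%:P).

Lemma rising0 y : rising y 0 = 1. Proof. by rewrite /rising big_ord0. Qed.

Lemma risingSr y n : rising y n.+1 = rising y n * (y + n%:R).
Proof. by rewrite /rising big_ord_recr. Qed.

Lemma risingS y n : rising y n.+1 = y * rising (y + 1) n.
Proof.
rewrite /rising big_ord_recl addr0; congr (_ * _).
by apply: eq_bigr => i _; rewrite /bump /= -nat1r addrA.
Qed.

Lemma rising_add y m n : rising y (m + n)%N = rising y m * rising (y + m%:R) n.
Proof.
rewrite /rising big_split_ord /=; congr (_ * _).
by apply: eq_bigr => i _; rewrite natrD addrA.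
Qed.

Lemma rising_shift y n : rising (y + 1) n * y = rising y n * (y + n%:R).
Proof. by rewrite mulrC -risingS risingSr. Qed.

Lemma rising_rev y n : \prod_(i < n) (y - i%:R) = rising (y + 1 - n%:R) n.
Proof.
rewrite (reindex_inj rev_ord_inj); apply: eq_bigr => i _ /=.
by rewrite natrB ?ltn_ord // -natr1; ring.
Qed.

Lemma rising_fact k n : rising (k%:R + 1) n * k`!%:R = (k + n)`!%:R :> R.
Proof.
elim: n => [|n IH]; first by rewrite rising0 mul1r addn0.
rewrite risingSr mulrAC IH addnS factS natrM mulrC; congr (_ * _).
by rewrite -natr1 natrD; ring.
Qed.

Lemma rising_gt0 y n : 0 < y -> 0 < rising y n.
Proof. by move=> y0; apply: prodr_gt0 => i _; rewrite ltr_wpDr. Qed.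

Lemma rising_double y n :
  rising (2 * y) (2 * n)%N = 2 ^+ (2 * n)%N * (rising y n * rising (y + 2^-1) n).
Proof.
elim: n => [|n IH]; first by rewrite muln0 !rising0 expr0 !mulr1.
rewrite (_ : 2 * n.+1 = (2 * n).+2)%N; last by lia.
rewrite !risingSr IH !exprS -(natr1 (2 * n)%N) natrM; field; rewrite ?pnatr_eq0 //.
Qed.

Lemma horner_rising_poly s n y : (rising_poly s n).[y] = rising (y + s) n.
Proof.
rewrite /rising_poly horner_prod; apply: eq_bigr => i _.
by rewrite hornerD hornerX hornerC addrA.
Qed.

Lemma monic_rising_poly s n : rising_poly s n \is monic.
Proof. by apply: monic_prod => i _; rewrite monicXaddC. Qed.

Lemma size_rising_poly s n : size (rising_poly s n) = n.+1.
Proof.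
rewrite size_prod => [|i _]; last by rewrite -size_poly_eq0 size_XaddC.
rewrite (eq_bigr (fun=> 2%N)) => [|i _]; last by rewrite size_XaddC.
by rewrite sum_nat_const card_ord; lia.
Qed.

(** Newton's forward difference formula: the [k]-th difference of a rising factorial is a shorter
    one times a falling factorial. *)
Lemma rising_differences y nu i K : (i < K)%N ->
  rising (y + i%:R) nu =
  \sum_(k < K) 'C(i, k)%:R * ((nu ^_ k)%:R * rising (y + k%:R) (nu - k)%N).
Proof.
elim: i K y nu => [|i IH] [|K] y nu // lt.
  rewrite big_ord_recl big1 => [|k _]; last by rewrite bin0n mul0r.
  by rewrite bin0 ffactn0 subn0 !mul1r !addr0.
have stepE : rising (y + i.+1%:R) nu =
    rising (y + i%:R) nu + nu%:R * rising (y + 1 + i%:R) nu.-1.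
  case: nu => [|nu]; first by rewrite !rising0 mul0r addr0.
  rewrite [in RHS]risingS (_ : y + i.+1%:R = y + i%:R + 1); last by rewrite -natr1 addrA.
  by rewrite risingSr (_ : y + 1 + i%:R = y + i%:R + 1) /= -?natr1; ring.
rewrite stepE (IH K.+1 y nu) 1?ltnW // (IH K (y + 1)) //.
rewrite !big_ord_recl !bin0 -addrA; congr (_ + _).
rewrite big_distrr -big_split /=; apply: eq_bigr => k _.
rewrite /bump /= ?add1n binS natrD mulrDl; congr (_ + _).
rewrite ffactnS natrM -addrA -nat1r (_ : nu.-1 - k = nu - k.+1)%N; last by lia.
by ring.
Qed.

(** Monic polynomials of degrees 0, ..., [n - 1] arise from the monomials by a unitriangular
    matrix. *)
Lemma det_monic_polys n (p : 'I_n -> {poly R}) (s : 'rV[R]_n) :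
  (forall i, p i \is monic) -> (forall i, size (p i) = i.+1) ->
  \det (\matrix_(i, j) (p i).[s 0 j]) =
  \prod_(i < n) \prod_(j < n | (i < j)%N) (s 0 j - s 0 i).
Proof.
move=> mon sz; rewrite -det_Vandermonde.
pose A : 'M[R]_n := \matrix_(i, k) (p i)`_k.
have -> : \matrix_(i, j) (p i).[s 0 j] = A *m Vandermonde n s.
  apply/matrixP=> i j; rewrite !mxE (@horner_coef_wide _ n) ?sz //.
  by apply: eq_bigr => k _; rewrite !mxE.
rewrite det_mulmx (det_trig (_ : is_trig_mx A)).
  rewrite big1 ?mul1r // => i _; rewrite mxE.
  by have /monicP := mon i; rewrite /lead_coef sz.
by apply/is_trig_mxP=> i j lt; rewrite mxE nth_default // sz.
Qed.

Definition Vdesc n (s : 'rV[R]_n) := \prod_(i < n) \prod_(j < n | (i < j)%N) (s 0 i - s 0 j).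

Lemma Vdesc_row m n (s : 'rV[R]_m) (t : 'rV[R]_n) :
  Vdesc (row_mx s t) =
  Vdesc s * Vdesc t * \prod_(i < m) \prod_(j < n) (s 0 i - t 0 j).
Proof.
rewrite /Vdesc big_split_ord /= mulrAC; congr (_ * _).
  rewrite -big_split /=; apply: eq_bigr => i _; rewrite big_split_ord /=; congr (_ * _).
    by apply: eq_bigr => j _; rewrite !row_mxEl.
  apply: eq_big => j; last by rewrite row_mxEl row_mxEr.
  by rewrite (leq_trans (ltn_ord i)) // leq_addr.
apply: eq_bigr => i _; rewrite big_split_ord /= big_pred0 ?mul1r => [|j].
  by apply: eq_big => [j|j _]; rewrite ?ltn_add2l // !row_mxEr.
by apply/negbTE; rewrite -leqNgt (leq_trans (ltnW (ltn_ord j))) // leq_addr.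
Qed.

(** Newton's formula in [i] factors the matrix into Pascal's triangle, a diagonal of falling
    factorials and [K], whose row [k] is a monic polynomial of degree [n - 1 - k] in the shifts. *)
Lemma det_rising n (y : R) (s : 'rV[R]_n) :
  \det (\matrix_(i < n, j < n) rising (y + i%:R + s 0 j) n.-1) =
  (\prod_(i < n) (n.-1`!%:R / i`!%:R)) * Vdesc s.
Proof.
pose L : 'M[R]_n := \matrix_(i, k) 'C(i, k)%:R.
pose K : 'M[R]_n := \matrix_(k, j) rising (y + k%:R + s 0 j) (n.-1 - k)%N.
pose d : 'rV[R]_n := \row_k (n.-1 ^_ k)%:R.
have -> : \matrix_(i < n, j < n) rising (y + i%:R + s 0 j) n.-1 = L *m (diag_mx d *m K).
  apply/matrixP=> i j; rewrite !mxE addrAC (@rising_differences _ _ i n) //.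
  by apply: eq_bigr => k _; rewrite mul_diag_mx !mxE (addrAC y).
rewrite !det_mulmx det_diag (det_trig (_ : is_trig_mx L)); last first.
  by apply/is_trig_mxP=> i j lt; rewrite mxE bin_small.
rewrite big1 ?mul1r => [|i _]; last by rewrite mxE binn.
congr (_ * _).
  rewrite [RHS](reindex_inj rev_ord_inj); apply: eq_bigr => i _ /=; rewrite mxE.
  have -> : (n - i.+1 = n.-1 - i)%N by lia.
  have le : (i <= n.-1)%N by have := ltn_ord i; lia.
  rewrite -(ffact_fact le) natrM mulfK // pnatr_eq0 -lt0n fact_gt0 //.
(* Reversing both indices makes the degrees increase and turns the Vandermonde product into
   [Vdesc]. *)
rewrite -det_rev; pose s' : 'rV[R]_n := \row_j s 0 (rev_ord j).
have -> : \matrix_(i, j) K (rev_ord i) (rev_ord j) =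
    \matrix_(i, j) (rising_poly (y + (rev_ord i)%:R) i).[s' 0 j].
  apply/matrixP=> i j; rewrite !mxE horner_rising_poly addrC.
  by congr rising; rewrite /=; have := ltn_ord i; lia.
rewrite det_monic_polys; [|by move=> i; apply: monic_rising_poly|by move=> i; apply: size_rising_poly].
rewrite /Vdesc [LHS](exchange_big_dep xpredT) //= (reindex_inj rev_ord_inj); apply: eq_bigr => i _.
rewrite (reindex_inj rev_ord_inj); apply: eq_big => [j|j _] /=.
  by have := ltn_ord i; have := ltn_ord j; lia.
by rewrite !mxE !rev_ordK.
Qed.
End Determinants.

(** * From binomial coefficients to a Vandermonde determinant *)

Section Evaluation.
Variable R : numFieldType.

Lemma fact_neq0 k : k`!%:R != 0 :> R.
Proof. by rewrite pnatr_eq0 -lt0n fact_gt0. Qed.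

Lemma rising_eq0 k n : (k < n)%N -> rising (- k%:R : R) n = 0.
Proof.
move=> lt; rewrite /rising (bigD1 (Ordinal lt)) //= addNr mul0r //.
Qed.

Lemma rising_neg_eq0 (y : R) k n : y = - k%:R -> (k < n)%N -> rising y n = 0.
Proof. by move=> ->; apply: rising_eq0. Qed.

Lemma rising1 n : rising 1 n = n`!%:R :> R.
Proof. by have := @rising_fact R 0 n; rewrite add0r mulr1. Qed.

Lemma prod_differences n :
  \prod_(i < n) \prod_(j < n | (i < j)%N) (j%:R - i%:R) = \prod_(j < n) j`!%:R :> R.
Proof.
rewrite (exchange_big_dep xpredT) //=; apply: eq_bigr => j _.
rewrite -(big_ord_widen n (fun i => j%:R - i%:R : R)) 1?ltnW // rising_rev -rising1.
by congr rising; ring.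
Qed.

(** The first factor vanishes at [t], ..., [t + j - 1]; the second one raises the degree to
    [A - 1]. *)
Definition basis_poly (t : R) (v : nat -> R) A j : {poly R} :=
  rising_poly (1 - t - j%:R) j * rising_poly (v j) (A.-1 - j)%N.

Lemma size_basis_poly t v A j : (j < A)%N -> size (basis_poly t v A j) = A.
Proof.
move=> lt; rewrite size_monicM ?monic_rising_poly //; last first.
  by rewrite -size_poly_eq0 size_rising_poly.
by rewrite !size_rising_poly; lia.
Qed.

Definition coef_mx n (f : nat -> {poly R}) : 'M[R]_n := \matrix_(k, j) (f j)`_k.

(** At the points [t], ..., [t + A - 1] the values form a triangular matrix; dividing by the
    Vandermonde determinant of the points leaves the determinant of the coefficients. *)
Lemma det_basis_poly t v A :
  \det (coef_mx A (basis_poly t v A)) =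
  \prod_(j < A) rising (t + j%:R + v j) (A.-1 - j)%N.
Proof.
set f := basis_poly t v A.
pose pts : 'rV[R]_A := \row_i (t + i%:R).
have sf0 : \prod_(j < A) j`!%:R != 0 :> R by apply/prodf_neq0 => j _; apply: fact_neq0.
have VE : \det (Vandermonde A pts) = \prod_(j < A) j`!%:R.
  rewrite det_Vandermonde -prod_differences; apply: eq_bigr => i _.
  by apply: eq_bigr => j _; rewrite !mxE; ring.
apply: (mulfI sf0); rewrite -{1}VE -det_tr -det_mulmx -big_split /=.
have -> : (Vandermonde A pts)^T *m coef_mx A f = \matrix_(i, j) (f j).[t + i%:R].
  apply/matrixP=> i j; rewrite !mxE (@horner_coef_wide _ A) ?size_basis_poly //.
  by apply: eq_bigr => k _; rewrite !mxE mulrC.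
rewrite det_trig; last first.
  apply/is_trig_mxP=> i j lt; rewrite mxE hornerM horner_rising_poly.
  rewrite (@rising_neg_eq0 _ (j - i.+1)%N) ?mul0r //; last by lia.
  by rewrite natrB // -natr1; ring.
apply: eq_bigr => j _; rewrite mxE hornerM !horner_rising_poly; congr (_ * _).
by rewrite -rising1; congr rising; ring.
Qed.

Definition two_blocks a x (Q P pt : nat -> R) (f g : nat -> {poly R}) : 'M[R]_(a + x) :=
  row_mx (\matrix_(i < a + x, j < a) (Q i * (f j).[pt i]))
         (\matrix_(i < a + x, j < x) (P i * (g j).[pt i])).

(** Each block has its own change of basis, so any two pairs of families can be compared through the
    monomials. *)
Lemma det_two_blocks a x Q P pt (f g : nat -> {poly R}) :
  (forall j, (j < a)%N -> size (f j) <= a)%N ->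
  (forall j, (j < x)%N -> size (g j) <= x)%N ->
  \det (two_blocks a x Q P pt f g) =
  \det (two_blocks a x Q P pt (fun j => 'X^j) (fun j => 'X^j))
  * (\det (coef_mx a f) * \det (coef_mx x g)).
Proof.
move=> sf sg; rewrite -(det_ublock (coef_mx a f) 0 (coef_mx x g)) -det_mulmx; congr (\det _).
rewrite mul_row_block !mulmx0 addr0 add0r; congr row_mx.
  apply/matrixP=> i j; rewrite !mxE (@horner_coef_wide _ a) ?sf // big_distrr /=.
  by apply: eq_bigr => k _; rewrite !mxE hornerXn; ring.
apply/matrixP=> i j; rewrite !mxE (@horner_coef_wide _ x) ?sg // big_distrr /=.
by apply: eq_bigr => k _; rewrite !mxE hornerXn; ring.
Qed.

(** Shifts for [det_rising]; the last [be] are chosen so that their columns vanish at [c], ...,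
    [c + a + x - 1]. *)
Definition slopes a x be (c : nat) (q p : R) : 'rV[R]_(a + x + be) :=
  row_mx (row_mx (\row_(j < a) (q - j%:R)) (\row_(j < x) (p - j%:R)))
         (\row_(j < be) (1 - (c + (a + x))%:R - j%:R)).

(** With [n = a + x + be], the matrix of [det_rising] is block triangular: the last [be] columns
    vanish in the first [a + x] rows, and in the other rows they are triangular with diagonal
    entries [(n - 1)!]. *)
Lemma det_rising_blocks a x be c q p :
  \det (row_mx (\matrix_(i < a + x, j < a) rising (c%:R + i%:R + (q - j%:R)) (a + x + be).-1)
               (\matrix_(i < a + x, j < x) rising (c%:R + i%:R + (p - j%:R)) (a + x + be).-1))
  * (a + x + be).-1`!%:R ^+ be =
  (\prod_(i < a + x + be) ((a + x + be).-1`!%:R / i`!%:R)) * Vdesc (slopes a x be c q p).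
Proof.
have E1 (j : 'I_a) : slopes a x be c q p 0 (lshift be (lshift x j)) = q - j%:R.
  by rewrite /slopes !row_mxEl mxE.
have E2 (j : 'I_x) : slopes a x be c q p 0 (lshift be (rshift a j)) = p - j%:R.
  by rewrite /slopes row_mxEl row_mxEr mxE.
have E3 (j : 'I_be) :
    slopes a x be c q p 0 (rshift (a + x) j) = 1 - (c + (a + x))%:R - j%:R.
  by rewrite /slopes row_mxEr mxE.
rewrite -(det_rising c%:R); move: (slopes a x be c q p) E1 E2 E3 => s E1 E2 E3.
set W := (X in _ = \det X).
rewrite -[W]submxK (_ : ursubmx W = 0) ?det_lblock; last first.
  apply/matrixP=> i j; rewrite !mxE E3 /=.
  have := ltn_ord i; have := ltn_ord j => ltj lti.
  apply: (@rising_neg_eq0 _ (a + x - i.+1 + j)%N); last by lia.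
  by rewrite (natrD _ (a + x - i.+1)) natrB // (natrD _ c) -[i.+1%:R]natr1; ring.
congr (\det _ * _).
  apply/matrixP=> i j; rewrite !mxE; case: splitP => k kj; rewrite !mxE.
    by rewrite (_ : j = lshift x k) ?E1 //; apply: val_inj.
  by rewrite (_ : j = rshift a k) ?E2 //; apply: val_inj.
rewrite det_trig.
  rewrite (eq_bigr (fun=> (a + x + be).-1`!%:R)) ?prodr_const ?card_ord // => i _.
  by rewrite !mxE E3 -rising1 /= !natrD; congr rising; ring.
apply/is_trig_mxP=> i j lt; rewrite !mxE E3 /=.
have := ltn_ord i; have := ltn_ord j => ltj lti.
apply: (@rising_neg_eq0 _ (j - i.+1)%N); last by lia.
by rewrite natrB // !natrD -[i.+1%:R]natr1; ring.
Qed.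

(** The binomial coefficient is a factor independent of [j] times a basis polynomial in [M]; for
    [j > M] both sides vanish. *)
Lemma walks_basis M d A j : (j < A)%N ->
  (walks (2 * M + d + 1) (d + 1 + 2 * j)%:Z)%:R =
  (2 * M + d + 1)`!%:R / (M`!%:R * (M + d + A)`!%:R)
  * (rising (M%:R + (1 - j%:R)) j * rising (M%:R + (d + j + 2)%:R) (A.-1 - j)%N) :> R.
Proof.
move=> lt; have [le|gt] := leqP j M; last first.
  rewrite walks_out; last by lia.
  rewrite (@rising_neg_eq0 _ (j - M.+1)%N) ?mul0r ?mulr0 //; last by lia.
  by rewrite natrB // -natr1; ring.
rewrite (_ : (d + 1 + 2 * j)%:Z = (2 * M + d + 1)%:Z - (2 * (M - j))%:Z); last by lia.
have e1 := rising_fact R (M - j) j; rewrite subnK // natrB // in e1.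
have e2 := rising_fact R (M + d + j + 1) (A.-1 - j).
rewrite (_ : M + d + j + 1 + (A.-1 - j) = M + d + A)%N in e2; last by lia.
have e3 : 'C(2 * M + d + 1, M - j)%:R * ((M - j)`!%:R * (M + d + j + 1)`!%:R)
    = (2 * M + d + 1)`!%:R :> R.
  rewrite -!natrM (_ : M + d + j + 1 = 2 * M + d + 1 - (M - j))%N; last by lia.
  by rewrite bin_fact //; lia.
rewrite walks_bin -e3 -e2 -[M`!%:R]e1.
rewrite (_ : M%:R + (1 - j%:R) = M%:R - j%:R + 1); last by ring.
rewrite (_ : M%:R + (d + j + 2)%:R = (M + d + j + 1)%:R + 1); last by rewrite !natrD; ring.
have n1 : rising (M%:R - j%:R + 1) j != 0 :> R.
  by rewrite gt_eqF // rising_gt0 // -natrB // ltr_wpDl.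
have n2 : rising ((M + d + j + 1)%:R + 1) (A.-1 - j)%N != 0 :> R.
  by rewrite gt_eqF // rising_gt0 // ltr_wpDl.
have n3 := fact_neq0 (M - j); have n4 := fact_neq0 (M + d + j + 1).
by field; rewrite n1 n2 n3 n4.
Qed.

Lemma rising_even_odd (m k : nat) (eps : bool) :
  rising ((2 * m).+1%:R + 1) (2 * k + eps)%N =
  2 ^+ (2 * k + eps)%N * (rising (m%:R + 1) (k + eps)%N * rising (m%:R + 3 / 2) k) :> R.
Proof.
have two0 : 2 != 0 :> R by rewrite pnatr_eq0.
rewrite (_ : (2 * m).+1%:R + 1 = 2 * (m%:R + 1)); last by rewrite -natr1 natrM; ring.
rewrite (_ : m%:R + 3 / 2 = m%:R + 1 + 2^-1); last by field.
case: eps; rewrite ?addn0 ?rising_double // !addn1 !risingSr rising_double exprS natrM.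
by ring.
Qed.

Section Blocks.
Variables (x a be c : nat) (eps : bool).
Let b := (2 * be + eps)%N.
Let n := (a + x + be)%N.

Lemma det_paths_walks :
  rows_det [seq paths R x a b c 0 (2 * j + 1)%N | j <- iota 0 (a + x)] =
  \det (row_mx
   (\matrix_(i < a + x, j < a) (walks (2 * (c + i) + 0 + 1) (0 + 1 + 2 * j)%:Z)%:R)
   (\matrix_(i < a + x, j < x) (walks (2 * (c + i + a) + b + 1) (b + 1 + 2 * j)%:Z)%:R)) :> R.
Proof.
pose K : 'M[R]_(a + x) := \matrix_(i, t) (if (t < i.+1)%N then 'C((2 * i).+1, i - t)%:R else 0).
have detK : \det K = 1.
  rewrite det_trig.
    by rewrite big1 // => i _; rewrite mxE ltnSn subnn bin0.
  by apply/is_trig_mxP=> i j lt; rewrite mxE ltnS leqNgt lt.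
rewrite /rows_det -[LHS]mul1r -[X in X * _]detK -det_mulmx; congr (\det _).
have sumE (i : 'I_(a + x)) Y X :
    \sum_(t < a + x) K i t * (folded Y X 0 (2 * t + 1))%:R = (walks ((2 * i).+1 + Y) X%:Z)%:R.
  rewrite walks_fold natr_sum.
  rewrite (big_ord_widen (a + x) (fun t => ('C((2 * i).+1, i - t) * folded Y X 0 (2 * t + 1))%N%:R : R)) //.
  rewrite [RHS]big_mkcond; apply: eq_bigr => t _; rewrite mxE; case: ifP => _; last by rewrite mul0r.
  by rewrite natrM.
apply/matrixP=> i j; rewrite [LHS]mxE.
rewrite (eq_bigr (fun t : 'I_(a + x) => K i t * paths R x a b c 0 (2 * t + 1)%N 0 j)); last first.
  move=> t _; congr (_ * _); rewrite mxE (nth_map 0%N) ?size_iota // nth_iota //.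
case: (split_ordP j) => k ->; rewrite ?row_mxEl ?row_mxEr mxE.
  transitivity ((walks ((2 * i).+1 + 2 * c) (2 * k + 1)%:Z)%:R : R).
    by rewrite -sumE; apply: eq_bigr => t _; congr (_ * _); rewrite /paths row_mxEl mxE.
  by congr (_ *+ _); congr walks; lia.
transitivity ((walks ((2 * i).+1 + (2 * a + b + 2 * c)) (b + 1 + 2 * k)%:Z)%:R : R).
  by rewrite -sumE; apply: eq_bigr => t _; congr (_ * _); rewrite /paths row_mxEr mxE.
by congr (_ *+ _); congr walks; lia.
Qed.

Definition row_factor i : R := (2 * (c + i) + 1)`!%:R / ((c + i)`!%:R * (c + i + a)`!%:R).
Definition Qval i : R := rising ((c + i)%:R + (1 + a + be + eps)%:R) (x + be).
Definition Pval i : R := rising ((c + i)%:R + 3 / 2) (a + be).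

Lemma Qval_neq0 i : Qval i != 0.
Proof. by rewrite gt_eqF // rising_gt0 // ltr_wpDl // ltr0n. Qed.

(** The quotient of the leading factorials is a product of [2 * a + b] consecutive integers.
    Duplication splits it into powers of 2, half-integers, which give [Pval], and integers, which
    cancel in the denominator and leave [Qval]. *)
Lemma row_factor_south i :
  (2 * (c + i + a) + b + 1)`!%:R / ((c + i + a)`!%:R * (c + i + a + b + x)`!%:R) =
  row_factor i / Qval i * (Pval i * 2 ^+ (2 * a + b)).
Proof.
have Q0 := Qval_neq0 i; rewrite /row_factor.
have e1 := rising_fact R (2 * (c + i)).+1 (2 * a + b).
have e2 := rising_fact R (c + i) (a + be + eps + (x + be)).
have := rising_even_odd (c + i) (a + be) eps.
rewrite (_ : 2 * (a + be) + eps = 2 * a + b)%N /b; last by lia.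
move=> e3; rewrite {}e3 in e1.
rewrite (_ : (2 * (c + i)).+1 + _ = 2 * (c + i + a) + b + 1)%N in e1; last by rewrite /b; lia.
rewrite (_ : c + i + _ = c + i + a + b + x)%N in e2; last by rewrite /b; lia.
rewrite -/b -e1 -e2 (rising_add _ (a + be + eps)%N).
have -> : (c + i)%:R + 1 + (a + be + eps)%:R = (c + i)%:R + (1 + a + be + eps)%:R :> R.
  by rewrite !natrD; ring.
rewrite -/(Qval i) -/(Pval i) addn1.
have r0 : rising ((c + i)%:R + 1) (a + be + eps) != 0 :> R.
  by rewrite gt_eqF // rising_gt0 // ltr_wpDl.
have n1 := fact_neq0 (c + i); have n2 := fact_neq0 (c + i + a).
by field; rewrite Q0 r0 n1 n2.
Qed.

Let q : R := (1 + a + be + eps)%:R.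
Let p : R := 3 / 2.

(** This basis extends [rising (y + v) L] by [j] factors below and [A - 1 - j] above, so the product
    is one rising factorial of a length independent of [j]. *)
Lemma rising_basis (y v : R) A L j : (j < A)%N ->
  rising (y + v) L * (basis_poly (1 - v) (fun=> v + L%:R) A j).[y] =
  rising (y + (v - j%:R)) (L + A.-1)%N.
Proof.
move=> lt; rewrite hornerM !horner_rising_poly.
rewrite (_ : L + A.-1 = j + (L + (A.-1 - j)))%N; last by lia.
rewrite !rising_add [in RHS](_ : y + (v - j%:R) + j%:R = y + v); last by ring.
rewrite (_ : y + (1 - (1 - v) - j%:R) = y + (v - j%:R)); last by ring.
by rewrite (addrA y v L%:R) mulrCA.
Qed.

(** The products on the left are the coefficient determinants of the bases [f'] and [g'] adapted to
    [Qval] and [Pval]; those on the right belong to [f] and [g], which come from [walks_basis]. *)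
Lemma det_walks :
  \det (row_mx
   (\matrix_(i < a + x, j < a) (walks (2 * (c + i) + 0 + 1) (0 + 1 + 2 * j)%:Z)%:R)
   (\matrix_(i < a + x, j < x) (walks (2 * (c + i + a) + b + 1) (b + 1 + 2 * j)%:Z)%:R))
  * ((\prod_(j < a) rising ((x + be + j)%:R + 1) (a.-1 - j)%N)
     * (\prod_(j < x) rising ((a + be + j)%:R + 1) (x.-1 - j)%N)) * n.-1`!%:R ^+ be =
  (\prod_(i < a + x) (row_factor i / Qval i)) * (2 ^+ (2 * a + b)) ^+ x
  * ((\prod_(j < a) rising ((2 * j + 1)%:R + 1) (a.-1 - j)%N)
     * (\prod_(j < x) rising ((2 * j + b + 1)%:R + 1) (x.-1 - j)%N))
  * ((\prod_(i < n) (n.-1`!%:R / i`!%:R)) * Vdesc (slopes a x be c q p)) :> R.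
Proof.
pose pt i : R := (c + i)%:R.
pose f := basis_poly 0 (fun j => (j + 2)%:R) a.
pose g := basis_poly (- a%:R) (fun j => (a + b + j + 2)%:R) x.
pose f' := basis_poly (1 - q) (fun=> q + (x + be)%:R) a.
pose g' := basis_poly (1 - p) (fun=> p + (a + be)%:R) x.
set Wm := row_mx _ _.
pose d : 'rV[R]_(a + x) := \row_i (row_factor i / Qval i).
have WE : Wm = diag_mx d *m (two_blocks a x Qval Pval pt f g
    *m block_mx 1%:M 0 0 (2 ^+ (2 * a + b))%:M).
  rewrite mul_row_block !mulmx0 mulmx1 addr0 add0r mul_mx_row; congr row_mx.
    apply/matrixP=> i j; rewrite mul_diag_mx !mxE (@walks_basis _ 0 a) //.
    rewrite hornerM !horner_rising_poly !addn0 -/(row_factor i) subr0 add0n.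
    by rewrite mulrA divfK ?Qval_neq0.
  apply/matrixP=> i j; rewrite mul_diag_mx mul_mx_scalar !mxE (@walks_basis _ b x) //.
  rewrite hornerM !horner_rising_poly row_factor_south.
  rewrite (_ : (c + i + a)%:R + (1 - j%:R) = pt i + (1 - - a%:R - j%:R)); last first.
    by rewrite /pt natrD; ring.
  rewrite (_ : (c + i + a)%:R + (b + j + 2)%:R = pt i + (a + b + j + 2)%:R); last first.
    by rewrite /pt !natrD; ring.
  by ring.
have sz t v A j : (j < A)%N -> (size (basis_poly t v A j) <= A)%N.
  by move=> lt; rewrite size_basis_poly.
have cb : \det (two_blocks a x Qval Pval pt f g)
    * (\det (coef_mx a f') * \det (coef_mx x g')) =
    \det (two_blocks a x Qval Pval pt f' g') * (\det (coef_mx a f) * \det (coef_mx x g)).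
  rewrite (@det_two_blocks a x Qval Pval pt f g); try by move=> j; apply: sz.
  rewrite (@det_two_blocks a x Qval Pval pt f' g'); try by move=> j; apply: sz.
  by rewrite mulrAC.
have rb := det_rising_blocks a x be c q p.
have tE : two_blocks a x Qval Pval pt f' g' =
   row_mx (\matrix_(i < a + x, j < a) rising (c%:R + i%:R + (q - j%:R)) (a + x + be).-1)
          (\matrix_(i < a + x, j < x) rising (c%:R + i%:R + (p - j%:R)) (a + x + be).-1).
  congr row_mx; apply/matrixP=> i j; rewrite !mxE rising_basis // /pt natrD.
    by congr rising; have := ltn_ord j; lia.
  by congr rising; have := ltn_ord j; lia.
rewrite -tE in rb.
have detF : \det (coef_mx a f) = \prod_(j < a) rising ((2 * j + 1)%:R + 1) (a.-1 - j)%N.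
  rewrite det_basis_poly; apply: eq_bigr => j _; congr rising.
  by rewrite !(natrM, natrD); ring.
have detG : \det (coef_mx x g) = \prod_(j < x) rising ((2 * j + b + 1)%:R + 1) (x.-1 - j)%N.
  rewrite det_basis_poly; apply: eq_bigr => j _; congr rising.
  by rewrite !(natrM, natrD); ring.
have detF' : \det (coef_mx a f') = \prod_(j < a) rising ((x + be + j)%:R + 1) (a.-1 - j)%N.
  rewrite det_basis_poly; apply: eq_bigr => j _; congr rising.
  by rewrite !natrD; ring.
have detG' : \det (coef_mx x g') = \prod_(j < x) rising ((a + be + j)%:R + 1) (x.-1 - j)%N.
  rewrite det_basis_poly; apply: eq_bigr => j _; congr rising.
  by rewrite !natrD; ring.
rewrite -detF -detG -detF' -detG' WE !det_mulmx det_ublock det1 det_scalar mul1r det_diag.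
rewrite (eq_bigr (fun i : 'I_(a + x) => row_factor i / Qval i)); last by move=> i _; rewrite mxE.
rewrite -[in RHS]rb.
move: (\det (two_blocks _ _ _ _ _ f g)) (\det (two_blocks _ _ _ _ _ f' g')) cb => D1 D2 cb.
set A1 := \prod_(i < _) _; set A2 := _ ^+ x; set A3 := _ ^+ be.
transitivity (A1 * A2 * A3 * (D1 * (\det (coef_mx a f') * \det (coef_mx x g')))); first by ring.
by rewrite cb; ring.
Qed.
End Blocks.
End Evaluation.

(** * The determinant in closed form *)

Section ClosedForm.
Variables (R : numFieldType) (a be c : nat) (eps : bool).
Let b := (2 * be + eps)%N.
Let q : R := (1 + a + be + eps)%:R.
Let p : R := 3 / 2.

(** The three parts of the Vandermonde product that pair different progressions of [slopes]; [z]
    stands for the progression of vanishing columns. *)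
Definition cross_qp x : R := \prod_(i < a) \prod_(j < x) (q - i%:R - (p - j%:R)).
Definition cross_qz x : R := \prod_(i < a) rising (q - i%:R - 1 + (c + (a + x))%:R) be.
Definition cross_pz x : R := \prod_(i < x) rising (2^-1 - i%:R + (c + (a + x))%:R) be.

Lemma Vdesc_arith n (y : R) : Vdesc (\row_(j < n) (y - j%:R)) = \prod_(j < n) j`!%:R.
Proof.
rewrite -prod_differences; apply: eq_bigr => i _; apply: eq_bigr => j _.
by rewrite !mxE; ring.
Qed.

Lemma Vdesc_slopes x : Vdesc (slopes a x be c q p) =
  \prod_(j < a) j`!%:R * \prod_(j < x) j`!%:R * cross_qp x
  * \prod_(j < be) j`!%:R * (cross_qz x * cross_pz x).
Proof.
have two0 : 2 != 0 :> R by rewrite pnatr_eq0.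
rewrite /slopes !Vdesc_row !Vdesc_arith big_split_ord /=; congr (_ * _ * _ * (_ * _)).
- by apply: eq_bigr => i _; apply: eq_bigr => j _; rewrite !mxE.
- apply: eq_bigr => i _; apply: eq_bigr => j _; rewrite row_mxEl !mxE.
  by rewrite !natrD; ring.
- apply: eq_bigr => i _; apply: eq_bigr => j _; rewrite row_mxEr !mxE.
  by rewrite /p !natrD; field.
Qed.

Lemma cross_qpS x :
  cross_qp x.+1 = cross_qp x * rising ((x + be + eps)%:R + 2^-1) a.
Proof.
have two0 : 2 != 0 :> R by rewrite pnatr_eq0.
rewrite /cross_qp; under eq_bigr => i _ do rewrite big_ord_recr.
rewrite big_split /=; congr (_ * _).
rewrite (_ : _ + 2^-1 = (q - p + x%:R) + 1 - a%:R); last first.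
  by rewrite /q /p !natrD; field.
by rewrite -rising_rev; apply: eq_bigr => i _; ring.
Qed.

Lemma cross_qzS x :
  cross_qz x.+1 * rising ((c + a + x + be + eps)%:R + 1) a =
  cross_qz x * rising ((c + a + x + b)%:R + 1) a.
Proof.
rewrite (_ : (c + a + x + be + eps)%:R + 1 = (c + a + x + be + eps + a)%:R + 1 - a%:R);
  last by rewrite !natrD; ring.
rewrite (_ : (c + a + x + b)%:R + 1 = (c + a + x + b + a)%:R + 1 - a%:R);
  last by rewrite !natrD; ring.
rewrite -!rising_rev -!big_split /=; apply: eq_bigr => i _.
rewrite (_ : q - i%:R - 1 + (c + (a + x.+1))%:R = q - i%:R - 1 + (c + (a + x))%:R + 1); last first.
  by rewrite !natrD -(natr1 x); ring.
rewrite (_ : (c + a + x + be + eps + a)%:R - i%:R = q - i%:R - 1 + (c + (a + x))%:R); last first.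
  by rewrite /q !natrD; ring.
by rewrite rising_shift; congr (_ * _); rewrite /q /b !(natrM, natrD); ring.
Qed.

Lemma cross_pzS x :
  cross_pz x.+1 = cross_pz x * rising ((c + a + x)%:R + 3 / 2) be.
Proof.
have two0 : 2 != 0 :> R by rewrite pnatr_eq0.
rewrite /cross_pz big_ord_recl mulrC; congr (_ * _).
  apply: eq_bigr => i _; by congr rising; rewrite lift0 !addnS -!natr1 !natrD; ring.
by congr rising; rewrite /= subr0 !addnS -natr1 !natrD; field.
Qed.

Definition prodQ x : R := \prod_(i < a + x) Qval R x a be c eps i.

Lemma prodQS x : prodQ x.+1 =
  prodQ x * rising ((c + a + x + b)%:R + 1) (a + x)
  * rising ((c + a + x + a + be + eps)%:R + 1) (x.+1 + be).
Proof.
rewrite /prodQ addnS big_ord_recr /=; congr (_ * _); last first.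
  by rewrite /Qval; congr rising; rewrite !natrD; ring.
rewrite [X in _ * X]/rising -big_split /=; apply: eq_bigr => i _.
rewrite /Qval addSn risingSr; congr (_ * _).
by rewrite /b !(natrM, natrD); ring.
Qed.

Lemma Qval_gt0 x i : 0 < Qval R x a be c eps i.
Proof. by rewrite rising_gt0 // ltr_wpDl // ltr0n. Qed.

Lemma prodQ_neq0 x : prodQ x != 0.
Proof. by apply/prodf_neq0 => i _; rewrite gt_eqF // Qval_gt0. Qed.

(** Here the change-of-basis products depending on [x] are rewritten with factorials, so that the
    powers of [(n - 1)!] cancel and each product changes by few factors from [x] to [x.+1]. *)
Definition closed_form x : R :=
  \prod_(i < a + x) row_factor R a c i / prodQ x * (2 ^+ (2 * a + b)) ^+ x
  * (\prod_(j < a) rising ((2 * j + 1)%:R + 1) (a.-1 - j)%N * \prod_(j < a) (x + be + j)`!%:R)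
  * (\prod_(j < x) ((x + b + j)`!%:R / (2 * j + b + 1)`!%:R) * \prod_(j < x) (a + be + j)`!%:R)
  / \prod_(i < a + x + be) i`!%:R
  * (\prod_(j < a) j`!%:R * \prod_(j < x) j`!%:R * cross_qp x
     * \prod_(j < be) j`!%:R * (cross_qz x * cross_pz x)).

(** Each factorial completes its rising factorial to the same [d!]. The guard [0 < A] is there
    because [A.-1] truncates. *)
Lemma prod_rising_fact A L d : ((0 < A)%N -> (L + A.-1)%N = d) ->
  \prod_(j < A) rising ((L + j)%:R + 1) (A.-1 - j)%N * \prod_(j < A) (L + j)`!%:R
  = d`!%:R ^+ A :> R.
Proof.
move=> Ed; rewrite -big_split /= -[A in RHS]card_ord -prodr_const; apply: eq_bigr => j _.
have lt := ltn_ord j; rewrite rising_fact -Ed; last by lia.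
by congr (_`!%:R); lia.
Qed.

Theorem det_paths_closed_form x :
  rows_det [seq paths R x a b c 0 (2 * j + 1)%N | j <- iota 0 (a + x)] = closed_form x.
Proof.
rewrite det_paths_walks; set D := \det _.
have := det_walks R x a be c eps; rewrite -/D -/b -/q -/p Vdesc_slopes.
set n1 := (a + x + be).-1.
have fa : \prod_(j < a) rising ((x + be + j)%:R + 1) (a.-1 - j)%N * \prod_(j < a) (x + be + j)`!%:R
  = n1`!%:R ^+ a :> R by apply: prod_rising_fact; rewrite /n1; lia.
have fx : \prod_(j < x) rising ((a + be + j)%:R + 1) (x.-1 - j)%N * \prod_(j < x) (a + be + j)`!%:R
  = n1`!%:R ^+ x :> R by apply: prod_rising_fact; rewrite /n1; lia.
have fg : \prod_(j < x) rising ((2 * j + b + 1)%:R + 1) (x.-1 - j)%N =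
    \prod_(j < x) ((x + b + j)`!%:R / (2 * j + b + 1)`!%:R) :> R.
  apply: eq_bigr => j _; apply/(canRL (mulfK (fact_neq0 R _))).
  by rewrite rising_fact; congr (_`!%:R); have := ltn_ord j; lia.
have fn : \prod_(i < a + x + be) (n1`!%:R / i`!%:R) =
    n1`!%:R ^+ a * n1`!%:R ^+ x * n1`!%:R ^+ be / \prod_(i < a + x + be) i`!%:R :> R.
  by rewrite prodf_div prodr_const card_ord !exprD.
have n10 : n1`!%:R != 0 :> R by apply: fact_neq0.
have p1 : \prod_(j < a) (x + be + j)`!%:R != 0 :> R by apply/prodf_neq0 => j _; apply: fact_neq0.
have p2 : \prod_(j < x) (a + be + j)`!%:R != 0 :> R by apply/prodf_neq0 => j _; apply: fact_neq0.
have p3 : \prod_(i < a + x + be) i`!%:R != 0 :> R by apply/prodf_neq0 => j _; apply: fact_neq0.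
rewrite -/n1 fg fn -fa -fx prodf_div -/(prodQ x).
have q0 := prodQ_neq0 x.
set a1 := \prod_(j < a) rising ((x + be + j)%:R + 1) _.
set a2 := \prod_(j < x) rising ((a + be + j)%:R + 1) _.
have a10 : a1 != 0 by apply/prodf_neq0 => j _; rewrite gt_eqF // rising_gt0 // ltr_wpDl.
have a20 : a2 != 0 by apply/prodf_neq0 => j _; rewrite gt_eqF // rising_gt0 // ltr_wpDl.
have n1b : n1`!%:R ^+ be != 0 :> R by rewrite expf_neq0.
move=> E; apply: (mulIf n1b); apply: (mulIf (mulf_neq0 a10 a20)).
rewrite [LHS]mulrAC E /closed_form; move: (n1`!%:R ^+ be) n1b => z z0.
move: (prodQ x) q0 => Qx q0.
move: (\prod_(i < a + x + be) i`!%:R) p3 => p3 p30.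
by field; rewrite p30 q0.
Qed.

(** The quotient of consecutive values of [closed_form]. It involves [be] and [eps] only through
    [b], so both parities are treated together. *)
Definition step_ratio x : R :=
  (2 * x + 2 * a + b + 2 * c + 1)`!%:R * (2 * x + 2 * a + b)`!%:R
  / ((2 * x + 2 * a + b + c + 1)`!%:R * (2 * x + 2 * a + b + c)`!%:R)
  * ((x + 2 * a + b + c)`!%:R * x`!%:R / ((x + 2 * a + c)`!%:R * (x + b)`!%:R)).

Lemma prod_factS L x : \prod_(j < L) (x.+1 + be + j)`!%:R =
  \prod_(j < L) (x + be + j)`!%:R * rising ((x + be)%:R + 1) L :> R.
Proof.
rewrite /rising -big_split /=; apply: eq_bigr => j _.
by rewrite !addSn factS natrM mulrC -natr1 (natrD _ (x + be)); congr (_ * _); ring.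
Qed.

Lemma prod_fact_quotS x :
  \prod_(j < x.+1) ((x.+1 + b + j)`!%:R / (2 * j + b + 1)`!%:R) =
  \prod_(j < x) ((x + b + j)`!%:R / (2 * j + b + 1)`!%:R) * rising ((x + b)%:R + 1) x :> R.
Proof.
rewrite big_ord_recr /= (_ : x.+1 + b + x = 2 * x + b + 1)%N; last by lia.
rewrite divff ?fact_neq0 // mulr1 /rising -big_split /=; apply: eq_bigr => j _.
rewrite !addSn factS natrM -natr1 (natrD _ (x + b)) -mulrA mulrC; congr (_ * _); ring.
Qed.

(** The factorials of [step_ratio] are expressed by the rising factorials by which the parts of
    [closed_form] grow; the rest is an identity of rational functions. *)
Lemma closed_formS x : closed_form x.+1 = closed_form x * step_ratio x.
Proof.
have pos k n : rising (k%:R + 1) n != 0 :> R by rewrite gt_eqF // rising_gt0 // ltr_wpDl.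
have two0 : 2 != 0 :> R by rewrite pnatr_eq0.
(* The evaluation point added in passing from [x] to [x.+1]. *)
pose u := (c + a + x)%N.
have e1 : (2 * u + 1 + b)`!%:R = 2 ^+ b * (rising (u%:R + 1) (be + eps)%N
    * rising (u%:R + 3 / 2) be) * (2 * u + 1)`!%:R :> R.
  by rewrite addn1 -rising_even_odd rising_fact.
have e2 : (2 * x + 2 * a + b)`!%:R = 2 ^+ (2 * a) * (rising ((x + be)%:R + 1) a
    * rising ((x + be + eps)%:R + 2^-1) a) * (2 * x + b)`!%:R :> R.
  rewrite (_ : 2 * x + 2 * a + b = 2 * x + b + 2 * a)%N; last by lia.
  (* Duplication starts at an integer or at a half-integer according to [eps]; the two resulting
     factors merely trade places. *)
  rewrite -rising_fact; congr (_ * _); rewrite /b; case: (eps).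
    rewrite (_ : (2 * x + (2 * be + true))%:R + 1 = 2 * ((x + be)%:R + 1)); last first.
      by rewrite /= !(natrM, natrD); ring.
    rewrite rising_double; congr (_ * (_ * rising _ _)).
    by rewrite /= !natrD; field.
  rewrite (_ : (2 * x + (2 * be + false))%:R + 1 = 2 * ((x + be)%:R + 2^-1)); last first.
    by rewrite /= !(natrM, natrD); field.
  rewrite rising_double; congr (_ * _); rewrite mulrC; congr (rising _ _ * rising _ _).
    by field.
  by rewrite /= addn0.
have e3 : (2 * x + b)`!%:R = rising ((x + b)%:R + 1) x * (x + b)`!%:R :> R.
  by rewrite rising_fact; congr (_`!%:R); lia.
have e4 : (u + a + x + b + 1)`!%:R = rising (u%:R + 1) (be + eps)%N
    * (rising ((u + be + eps)%:R + 1) a * rising ((u + a + be + eps)%:R + 1) (x.+1 + be)%N)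
    * u`!%:R :> R.
  rewrite (_ : (u + a + be + eps)%:R + 1 = (u + be + eps)%:R + 1 + a%:R); last first.
    by rewrite !natrD; ring.
  rewrite -rising_add (_ : (u + be + eps)%:R + 1 = u%:R + 1 + (be + eps)%:R); last first.
    by rewrite !natrD; ring.
  by rewrite -rising_add rising_fact; congr (_`!%:R); rewrite /b; lia.
have e5 : (u + a + b + x)`!%:R = rising ((u + a + b)%:R + 1) x * (u + a + b)`!%:R :> R.
  by rewrite rising_fact.
have e6 : rising ((u + b)%:R + 1) (a + x)%N =
    rising ((u + b)%:R + 1) a * rising ((u + a + b)%:R + 1) x :> R.
  by rewrite rising_add; congr (_ * rising _ _); rewrite !natrD; ring.
have qz : cross_qz x.+1 = cross_qz x * rising ((u + b)%:R + 1) a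
    / rising ((u + be + eps)%:R + 1) a.
  by apply/(canRL (mulfK (pos _ _))); rewrite cross_qzS.
rewrite /closed_form prod_factS prod_fact_quotS prodQS cross_qpS qz cross_pzS.
rewrite (_ : a + x.+1 + be = (a + x + be).+1)%N; last by lia.
rewrite addnS !big_ord_recr /= -/u e6.
rewrite (_ : a + be + x = a + x + be)%N; last by lia.
rewrite [row_factor _ _ _ (a + x)]/row_factor addnA -/u.
rewrite /step_ratio (_ : 2 * x + 2 * a + b + 2 * c + 1 = 2 * u + 1 + b)%N; last by lia.
rewrite (_ : 2 * x + 2 * a + b + c + 1 = u + a + x + b + 1)%N; last by lia.
rewrite (_ : 2 * x + 2 * a + b + c = u + a + b + x)%N; last by lia.
rewrite (_ : x + 2 * a + b + c = u + a + b)%N; last by lia.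
rewrite (_ : x + 2 * a + c = u + a)%N; last by lia.
rewrite e1 e2 e3 e4 e5 [2 ^+ (2 * a + b)]exprD !exprSr.
have f1 := fact_neq0 R u; have f2 := fact_neq0 R (u + a).
have f3 := fact_neq0 R (u + a + b); have f4 := fact_neq0 R (x + b).
have f5 := fact_neq0 R (a + x + be).
have q0 := prodQ_neq0 x; have r1 := pos u (be + eps)%N.
have r2 := pos (u + be + eps)%N a; have r3 := pos (u + a + be + eps)%N (x.+1 + be)%N.
have r4 := pos (u + a + b)%N x; have r5 := pos (u + b)%N a.
have p30 : \prod_(i < a + x + be) i`!%:R != 0 :> R by apply/prodf_neq0 => j _; apply: fact_neq0.
field; do ?[apply/andP; split] => //.
Qed.

Theorem closed_form_prod x : closed_form x = closed_form 0 * \prod_(t < x) step_ratio t.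
Proof.
elim: x => [|x IH]; first by rewrite big_ord0 mulr1.
by rewrite closed_formS IH big_ord_recr /= mulrA.
Qed.
End ClosedForm.

(** * The products [T] and [V] *)

Section Products.
Variable R : numFieldType.
Implicit Types (y z w : R) (n : int) (k : nat).

(** The shift trades the factor [y] for [y + n]. For negative [n] these two stand in denominators,
    and positivity lets them cancel. *)
Lemma pochS y n : 0 < y -> 0 < y + n%:~R ->
  poch (y + 1) n * y = poch y n * (y + n%:~R).
Proof.
case: n => k y0; first by move=> _; exact: rising_shift.
rewrite /poch NegzE mulrNz => yn; rewrite big_ord_recl big_ord_recr /=.
have -> : y + 1 - 1%:R = y by ring.
have -> : \prod_(i < k) (y + 1 - (bump 0 i).+1%:R) = \prod_(i < k) (y - i.+1%:R).
  by apply: eq_bigr => i _; rewrite /bump /= add1n -[i.+2%:R]natr1; ring.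
rewrite !invfM mulrAC mulVf ?gt_eqF // mul1r -mulrA.
by rewrite mulVf ?mulr1 // gt_eqF.
Qed.

Lemma poch2S y n : 0 < y -> 0 < y + 2 * n%:~R ->
  poch2 (y + 2) n * y = poch2 y n * (y + 2 * n%:~R).
Proof.
case: n => k y0.
  move=> _; rewrite /poch2 -natrM mulrC.
  transitivity (\prod_(i < k.+1) (y + (2 * i)%:R)); last by rewrite big_ord_recr.
  rewrite big_ord_recl /= muln0 addr0; congr (_ * _); apply: eq_bigr => i _.
  rewrite /bump /= add1n mulnS natrD; ring.
rewrite /poch2 NegzE mulrNz mulrN -natrM => yn; rewrite big_ord_recl big_ord_recr /=.
have -> : y + 2 - (2 * 1)%:R = y by rewrite muln1; ring.
have -> : \prod_(i < k) (y + 2 - (2 * (bump 0 i).+1)%:R) = \prod_(i < k) (y - (2 * i.+1)%:R).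
  by apply: eq_bigr => i _; rewrite /bump /= add1n (mulnS 2 i.+1) natrD; ring.
rewrite !invfM mulrAC mulVf ?gt_eqF // mul1r -mulrA.
by rewrite mulVf ?mulr1 // gt_eqF.
Qed.

Lemma poch_gt0 y n : 0 < y -> 0 < y + n%:~R -> 0 < poch y n.
Proof.
case: n => k y0; first by move=> _; apply: rising_gt0.
rewrite NegzE mulrNz => yk; rewrite invr_gt0; apply: prodr_gt0 => i _.
by apply: lt_le_trans yk _; rewrite lerB // ler_nat.
Qed.

Lemma poch2_gt0 y n : 0 < y -> 0 < y + 2 * n%:~R -> 0 < poch2 y n.
Proof.
case: n => k y0; first by move=> _; apply: prodr_gt0 => i _; rewrite ltr_wpDr.
rewrite NegzE mulrNz mulrN -natrM => yk; rewrite invr_gt0; apply: prodr_gt0 => i _.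
by apply: lt_le_trans yk _; rewrite lerB // ler_nat leq_mul2l ltn_ord orbT.
Qed.

(** Factor [i] starts at [y + i] with length [n - 2 * i], so the shift trades [y + i] for
    [y + n - i]: an ascending product against a descending one. *)
Lemma TposS y n k : 0 < y -> (forall i, (i < k)%N -> 0 < y + n%:~R - i%:R) ->
  Tpos (y + 1) n k * \prod_(i < k) (y + i%:R)
  = Tpos y n k * \prod_(i < k) (y + n%:~R - i%:R).
Proof.
move=> y0 yn; rewrite -!big_split /=; apply: eq_bigr => i _.
have e : y + i%:R + (n - (2 * i)%:Z)%:~R = y + n%:~R - i%:R.
  by rewrite rmorphB /= -!pmulrn natrM; ring.
by rewrite addrAC pochS ?e // ?yn // ltr_wpDr.
Qed.

Lemma Tpos_gt0 y n k : 0 < y -> (forall i, (i < k)%N -> 0 < y + n%:~R - i%:R) ->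
  0 < Tpos y n k.
Proof.
move=> y0 yn; apply: prodr_gt0 => i _; apply: poch_gt0; first by rewrite ltr_wpDr.
by rewrite rmorphB /= -!pmulrn (_ : _ + _ = y + n%:~R - i%:R) ?yn // natrM; ring.
Qed.

Lemma VposS z n k : 0 < z -> (forall i, (i < k)%N -> 0 < z + 2 * n%:~R - (2 * i)%:R) ->
  Vpos (z + 2) n k * \prod_(i < k) (z + (2 * i)%:R)
  = Vpos z n k * \prod_(i < k) (z + 2 * n%:~R - (2 * i)%:R).
Proof.
move=> z0 zn; rewrite -!big_split /=; apply: eq_bigr => i _.
have e : z + (2 * i)%:R + 2 * (n - (2 * i)%:Z)%:~R = z + 2 * n%:~R - (2 * i)%:R.
  by rewrite rmorphB /= -!pmulrn natrM; ring.
by rewrite addrAC poch2S ?e // ?zn // ltr_wpDr.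
Qed.

Lemma Vpos_gt0 z n k : 0 < z -> (forall i, (i < k)%N -> 0 < z + 2 * n%:~R - (2 * i)%:R) ->
  0 < Vpos z n k.
Proof.
move=> z0 zn; apply: prodr_gt0 => i _; apply: poch2_gt0; first by rewrite ltr_wpDr.
by rewrite rmorphB /= -!pmulrn (_ : _ + _ = z + 2 * n%:~R - (2 * i)%:R) ?zn // natrM; ring.
Qed.

Lemma prod_pairs_up Y k :
  \prod_(i < k) ((Y + 1 + 2 * i)%:R * (Y + 2 + 2 * i)%:R) * Y`!%:R = (Y + 2 * k)`!%:R :> R.
Proof.
elim: k => [|k IH]; first by rewrite big_ord0 mul1r addn0.
rewrite big_ord_recr /= mulrAC IH (_ : Y + 2 * k.+1 = (Y + 2 * k).+2)%N; last by lia.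
rewrite !factS !natrM (_ : (Y + 2 * k).+2 = Y + 2 + 2 * k)%N; last by lia.
by rewrite (_ : (Y + 2 * k).+1 = Y + 1 + 2 * k)%N; [ring | lia].
Qed.

Lemma prod_pairs_down Z k : (2 * k <= Z)%N ->
  \prod_(i < k) ((Z - 2 * i)%:R * (Z - 2 * i - 1)%:R) * (Z - 2 * k)`!%:R = Z`!%:R :> R.
Proof.
elim: k => [|k IH] le; first by rewrite big_ord0 mul1r subn0.
rewrite big_ord_recr /= -[RHS]IH; last by lia.
rewrite (_ : Z - 2 * k = (Z - 2 * k.+1).+2)%N; last by lia.
rewrite !factS !natrM subn1 /=; ring.
Qed.

(* One of [z], [2 w] is odd, so the two double-step products interleave into factorials; *)
(* this is where the parities of [b] and [c] disappear.                                   *)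
Lemma VT_step (Y c : nat) z w (n1 n2 : int) : let k := (c.+1)./2 in
  (z = (Y + 2)%:R /\ 2 * w = (Y + 1)%:R /\ n1 = c%:Z - 1 /\ n2 = c%:Z) \/
  (z = (Y + 1)%:R /\ 2 * w = (Y + 2)%:R /\ n1 = c%:Z /\ n2 = c%:Z - 1) ->
  Vpos (z + 2) n1 k * Tpos (w + 1) n2 k =
  Vpos z n1 k * Tpos w n2 k *
  ((Y + 2 * c + 1)`!%:R * Y`!%:R / ((Y + c + 1)`!%:R * (Y + c)`!%:R))
  /\ 0 < Vpos z n1 k * Tpos w n2 k.
Proof.
move=> k H; have two0 : 0 < 2 :> R by rewrite ltr0n.
have kc : (2 * k = c \/ 2 * k = c.+1)%N by rewrite /k; lia.
have [z0 w0] : 0 < z /\ 0 < w.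
  split; first by case: H => [[-> _]|[-> _]]; rewrite ltr0n addnS.
  by rewrite -(pmulr_rgt0 w two0); case: H => [[_ [-> _]]|[_ [-> _]]]; rewrite ltr0n addnS.
have n12 i : (i < k)%N ->
    (z + 2 * n1%:~R - (2 * i)%:R) * (2 * (w + n2%:~R - i%:R)) =
    (Y + 2 * c + 1 - 2 * i)%:R * (Y + 2 * c + 1 - 2 * i - 1)%:R
    /\ 0 < z + 2 * n1%:~R - (2 * i)%:R /\ 0 < w + n2%:~R - i%:R.
  move=> ik; set U := (Y + 2 * c + 1 - 2 * i)%N.
  have UE : U%:R = Y%:R + 2 * c%:R + 1 - 2 * i%:R :> R.
    by rewrite /U natrB; [rewrite !(natrM, natrD); ring | lia].
  have U1E : (U - 1)%:R = U%:R - 1 :> R by rewrite natrB //; rewrite /U; lia.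
  have U0 : 0 < U%:R :> R by rewrite ltr0n /U; lia.
  have U10 : 0 < (U - 1)%:R :> R by rewrite ltr0n /U; lia.
  have [[zE wE]|[zE wE]] : (z + 2 * n1%:~R - (2 * i)%:R = (U - 1)%:R
      /\ 2 * (w + n2%:~R - i%:R) = U%:R) \/
      (z + 2 * n1%:~R - (2 * i)%:R = U%:R /\ 2 * (w + n2%:~R - i%:R) = (U - 1)%:R).
  - case: H => [[-> [w2 [-> ->]]]|[-> [w2 [-> ->]]]]; [left | right].
      split; first by rewrite U1E UE rmorphB /= -!pmulrn natrM natrD; ring.
      by rewrite mulrBr mulrDr w2 UE -!pmulrn natrD; ring.
    split; first by rewrite UE -!pmulrn natrM natrD; ring.
    by rewrite mulrBr mulrDr w2 rmorphB /= -!pmulrn U1E UE natrD; ring.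
  - by split; [rewrite zE wE mulrC | split; [rewrite zE | rewrite -(pmulr_rgt0 _ two0) wE]].
  - by split; [rewrite zE wE | split; [rewrite zE | rewrite -(pmulr_rgt0 _ two0) wE]].
have VS := @VposS z n1 k z0 (fun i ik => (n12 i ik).2.1).
have TS := @TposS w n2 k w0 (fun i ik => (n12 i ik).2.2).
have V0 := @Vpos_gt0 z n1 k z0 (fun i ik => (n12 i ik).2.1).
have T0 := @Tpos_gt0 w n2 k w0 (fun i ik => (n12 i ik).2.2).
split; last by rewrite mulr_gt0.
have up : \prod_(i < k) (z + (2 * i)%:R) * (2 ^+ k * \prod_(i < k) (w + i%:R)) * Y`!%:R
    = (Y + 2 * k)`!%:R.
  rewrite -prod_pairs_up; congr (_ * _).
  rewrite -[k in 2 ^+ k]card_ord -prodr_const -!big_split /=; apply: eq_bigr => i _.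
  rewrite mulrDr -natrM.
  by case: H => [[-> [-> _]]|[-> [-> _]]]; rewrite !natrD; ring.
have down : \prod_(i < k) (z + 2 * n1%:~R - (2 * i)%:R)
      * (2 ^+ k * \prod_(i < k) (w + n2%:~R - i%:R)) * (Y + 2 * c + 1 - 2 * k)`!%:R
    = (Y + 2 * c + 1)`!%:R.
  rewrite -(@prod_pairs_down (Y + 2 * c + 1)%N k); last by rewrite /k; lia.
  congr (_ * _); rewrite -[k in 2 ^+ k]card_ord -prodr_const -!big_split /=.
  by apply: eq_bigr => i _; rewrite (n12 i (ltn_ord i)).1.
(* For even [c] one has [2 * k = c], for odd [c] it is [c + 1]; the two factorials are the same up
   to order. *)
have fE : (Y + c + 1)`!%:R * (Y + c)`!%:R
    = (Y + 2 * k)`!%:R * (Y + 2 * c + 1 - 2 * k)`!%:R :> R.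
  case: kc => ->; first by rewrite mulrC; congr (_`!%:R * _`!%:R); lia.
  by congr (_`!%:R * _`!%:R); lia.
rewrite fE -up -down.
have p1 : \prod_(i < k) (z + (2 * i)%:R) != 0.
  by apply/prodf_neq0 => i _; rewrite gt_eqF // ltr_wpDr.
have p2 : \prod_(i < k) (w + i%:R) != 0.
  by apply/prodf_neq0 => i _; rewrite gt_eqF // ltr_wpDr.
have e2 : 2 ^+ k != 0 :> R by rewrite expf_neq0 // gt_eqF.
have f1 := fact_neq0 R Y; have f2 := fact_neq0 R (Y + 2 * c + 1 - 2 * k).
apply: (mulIf (mulf_neq0 p1 p2)).
transitivity ((Vpos (z + 2) n1 k * \prod_(i < k) (z + (2 * i)%:R))
    * (Tpos (w + 1) n2 k * \prod_(i < k) (w + i%:R))); first by ring.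
by rewrite VS TS; field; rewrite p1 p2 e2 f1 f2.
Qed.

(** The descending product of [TposS] runs from [x + d + b] to [x + d + 1], the ascending one from
    [x + 1] to [x + b]. *)
Lemma T_step x n b d : n = (b + d)%:Z - 1 ->
  Tpos ((x + 1)%:R + 1 : R) n b =
  Tpos ((x + 1)%:R : R) n b * ((x + d + b)`!%:R * x`!%:R / ((x + d)`!%:R * (x + b)`!%:R))
  /\ 0 < Tpos ((x + 1)%:R : R) n b.
Proof.
move=> nE.
have x0 : 0 < (x + 1)%:R :> R by rewrite ltr0n addn1.
have fE i : (i < b)%N -> (x + 1)%:R + n%:~R - i%:R = (x + d + (b - i.+1) + 1)%:R :> R.
  move=> ib; rewrite nE rmorphB /= -!pmulrn [RHS]natrD (natrD _ (x + d)) natrB //.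
  by rewrite !natrD -natr1; ring.
have pos i : (i < b)%N -> 0 < (x + 1)%:R + n%:~R - i%:R :> R.
  by move=> ib; rewrite fE // ltr0n addn1.
have TS := TposS x0 pos; split; last exact: Tpos_gt0.
have down : \prod_(i < b) ((x + 1)%:R + n%:~R - i%:R) * (x + d)`!%:R = (x + d + b)`!%:R :> R.
  rewrite -rising_fact; congr (_ * _); rewrite /rising (reindex_inj rev_ord_inj) /=.
  apply: eq_bigr => i _; rewrite fE; last by have := ltn_ord i; lia.
  by rewrite natr1 -natrD; congr (_%:R); have := ltn_ord i; lia.
have up : \prod_(i < b) ((x + 1)%:R + i%:R) * x`!%:R = (x + b)`!%:R :> R.
  by rewrite -rising_fact natrD.
have p1 : \prod_(i < b) ((x + 1)%:R + i%:R) != 0 :> R.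
  by apply/prodf_neq0 => i _; rewrite gt_eqF // ltr_wpDr.
apply: (mulIf p1); rewrite TS -up -down.
by field; rewrite p1 !fact_neq0.
Qed.
End Products.

(** * Comparison of both sides by their ratios in [x] *)

(** The region [P'] contributes [closed_form] at 0, and the factors [2 ^+ c] cancel. *)
Lemma M_B_step_ratio (R : numFieldType) (x a b c : nat) :
  M R (B' x a b c) = M R (P' c c a) * \prod_(t < x) step_ratio R a b./2 c (odd b) t.
Proof.
have bE : (2 * b./2 + odd b = b)%N by rewrite -[RHS]odd_double_half; lia.
apply: (@mulfI _ (2 ^+ c)); first by rewrite expf_neq0 // pnatr_eq0.
have HB := B_paths R x a b c; have HP := P_paths R a b c.
rewrite mulrA HB HP -bE !det_paths_closed_form [LHS]closed_form_prod.
by rewrite !bE.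
Qed.

Section Telescoping.
Variables (R : numFieldType) (a b c : nat).

Lemma telescope_ratio (F : nat -> R) (x : nat) :
  (forall t, F t.+1 = F t * step_ratio R a b./2 c (odd b) t) -> F 0%N != 0 ->
  \prod_(t < x) step_ratio R a b./2 c (odd b) t = F x / F 0%N.
Proof.
move=> FS F0; elim: x => [|x IH]; first by rewrite big_ord0 divff.
by rewrite big_ord_recr /= IH FS mulrAC.
Qed.

(** The first factor is the ratio in [VT_step] for [Y = 2 * t + 2 * a + b], the second the ratio in
    [T_step] for [d = 2 * a + c]. *)
Lemma step_ratio_split t : step_ratio R a b./2 c (odd b) t =
  ((2 * t + 2 * a + b + 2 * c + 1)`!%:R * (2 * t + 2 * a + b)`!%:R
  / ((2 * t + 2 * a + b + c + 1)`!%:R * (2 * t + 2 * a + b + c)`!%:R))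
  * ((t + (2 * a + c) + b)`!%:R * t`!%:R / ((t + (2 * a + c))`!%:R * (t + b)`!%:R)).
Proof.
have bE : (2 * b./2 + odd b = b)%N by rewrite -[RHS]odd_double_half; lia.
rewrite /step_ratio bE (_ : t + (2 * a + c) + b = t + 2 * a + b + c)%N; last by lia.
by rewrite (addnA t).
Qed.
End Telescoping.

Theorem theorem2p4 (R : realFieldType) (x a b c : nat) :
  let f : int := (c.+1)./2%:Z in
  (odd b ->
     M R (B' x a b c) =
       M R (P' c c a)
       * (V ((2 * x + 2 * a + b + 2)%:R : R) (c%:Z - 1) f
          / V ((2 * a + b + 2)%:R : R) (c%:Z - 1) f)
       * ((T ((x + 1)%:R : R) ((2 * a + b + c)%:Z - 1) b%:Z
           * T ((x + a)%:R + (b + 1)%:R / 2 : R) c%:Z f)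
          / (T (1 : R) ((2 * a + b + c)%:Z - 1) b%:Z
             * T (a%:R + (b + 1)%:R / 2 : R) c%:Z f)))
  /\
  (~~ odd b ->
     M R (B' x a b c) =
       M R (P' c c a)
       * (V ((2 * x + 2 * a + b + 1)%:R : R) c%:Z f
          / V ((2 * a + b + 1)%:R : R) c%:Z f)
       * ((T ((x + 1)%:R : R) ((2 * a + b + c)%:Z - 1) b%:Z
           * T ((x + a)%:R + (b + 2)%:R / 2 : R) (c%:Z - 1) f)
          / (T (1 : R) ((2 * a + b + c)%:Z - 1) b%:Z
             * T (a%:R + (b + 2)%:R / 2 : R) (c%:Z - 1) f))).
Proof.
move=> f; have two0 : 2 != 0 :> R by rewrite pnatr_eq0.
have nE : (2 * a + b + c)%:Z - 1 = (b + (2 * a + c))%:Z - 1 by lia.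
(* The two formulas differ only in the offsets [z0], [s0] and the lengths [n1], [n2]. *)
suff main (z0 s0 : nat) (n1 n2 : int) :
    (z0 = 2%N /\ s0 = 1%N /\ n1 = c%:Z - 1 /\ n2 = c%:Z) \/
    (z0 = 1%N /\ s0 = 2%N /\ n1 = c%:Z /\ n2 = c%:Z - 1) ->
    M R (B' x a b c) =
       M R (P' c c a)
       * (V ((2 * x + 2 * a + b + z0)%:R : R) n1 f
          / V ((2 * a + b + z0)%:R : R) n1 f)
       * ((T ((x + 1)%:R : R) ((2 * a + b + c)%:Z - 1) b%:Z
           * T ((x + a)%:R + (b + s0)%:R / 2 : R) n2 f)
          / (T (1 : R) ((2 * a + b + c)%:Z - 1) b%:Z
             * T (a%:R + (b + s0)%:R / 2 : R) n2 f)).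
  by split=> _; apply: main; [left | right].
move=> H.
(* The product of the numerators with [t] in place of [x]; at [t = 0] it is the product of the
   denominators. *)
pose Ft t : R := Vpos (2 * t + 2 * a + b + z0)%:R n1 (c.+1)./2
  * Tpos ((t + a)%:R + (b + s0)%:R / 2) n2 (c.+1)./2
  * Tpos (t + 1)%:R ((2 * a + b + c)%:Z - 1) b.
have HVT t : ((2 * t + 2 * a + b + z0)%:R = (2 * t + 2 * a + b + 2)%:R :> R /\
    2 * ((t + a)%:R + (b + s0)%:R / 2) = (2 * t + 2 * a + b + 1)%:R :> R /\ n1 = c%:Z - 1 /\ n2 = c%:Z) \/
    ((2 * t + 2 * a + b + z0)%:R = (2 * t + 2 * a + b + 1)%:R :> R /\
    2 * ((t + a)%:R + (b + s0)%:R / 2) = (2 * t + 2 * a + b + 2)%:R :> R /\ n1 = c%:Z /\ n2 = c%:Z - 1).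
  case: H => [[-> [-> [-> ->]]]|[-> [-> [-> ->]]]]; [left | right];
    by do !split=> //; rewrite !(natrM, natrD); field.
have VT t := VT_step (HVT t).
have TS t := @T_step R t _ b (2 * a + c) nE.
have FS t : Ft t.+1 = Ft t * step_ratio R a b./2 c (odd b) t.
  have [VTe _] := VT t; have [Te _] := TS t.
  rewrite /Ft (_ : (2 * t.+1 + 2 * a + b + z0)%:R = (2 * t + 2 * a + b + z0)%:R + 2 :> R); last first.
    by rewrite -natrD; congr (_%:R); lia.
  rewrite (_ : (t.+1 + a)%:R + (b + s0)%:R / 2 = (t + a)%:R + (b + s0)%:R / 2 + 1 :> R); last first.
    by rewrite addSn -natr1; ring.
  rewrite (_ : (t.+1 + 1)%:R = (t + 1)%:R + 1 :> R); last by rewrite addSn -natr1.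
  by rewrite VTe Te step_ratio_split; ring.
have [_ V0] := VT 0%N; have [_ T0] := TS 0%N.
have F0 : Ft 0%N != 0 by rewrite gt_eqF // /Ft mulr_gt0.
rewrite M_B_step_ratio (telescope_ratio x FS F0) -mulrA; congr (_ * _).
by rewrite /Ft /V /T /f /= muln0 !add0n mulf_div; congr (_ / _); ring.
Qed.
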